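(* Let $m\ge 1$ and $k\ge 0$ be integers, $\underline\lambda=(\lambda_1,\dots,\lambda_m)\in\mathbb{R}^m$, $\mu\in\mathbb{R}$, $\delta=\mu-\sum_{j}\lambda_j$, and assume $\delta\notin\{1,\tfrac32,2,\tfrac52,\dots,k\}$. Then there exists a family of $\mathfrak{sl}(2)$-equivariant linear maps, parametrized by the choice of non-singular matrices $[\alpha]_p=(\alpha^{\underline s}_{\underline i})_{|\underline s|=|\underline i|=p}$, $p=0,\dots,k$, given by $$\sigma^{\alpha}_{\underline\lambda,\mu}:\mathcal{D}^k_{\underline\lambda;\mu}\longrightarrow\bigoplus_{j=0}^k\mathcal{S}^{(j)}_{\delta-j},\qquad A=\sum_{|\underline i|\le k}a_{\underline i}\,\partial_{\underline i}\ \longmapsto\ \sum_{r=0}^k\sum_{|\underline i|=r}\overline a_{\underline i}\,(dx)^{\delta-|\underline i|},$$ where $$\overline a_{\underline i}=\sum_{|\underline i|\le|\underline s|\le k}\alpha^{\underline s}_{\underline i}\;a_{\underline s}^{(|\underline s|-|\underline i|)}$$ and the constants $\alpha^{\underline s}_{\underline i}$ with $|\underline i|<|\underline s|\le k$ are determined from those with $|\underline s|=|\underline i|$ by the induction formula $$(|\underline s|-|\underline i|)\,(2\delta-|\underline s|-|\underline i|-1)\,\alpha^{\underline s}_{\underline i}-\sum_{j=1}^m s_j\,(2\lambda_j+s_j-1)\,\alpha^{\underline s-\mathbf 1_j}_{\underline i}=0 .$$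
   Context: $M$ is $\mathbb{R}$ or $S^1$ (for $S^1$, identified with the projective line, $x$ is an affine coordinate). For $\lambda\in\mathbb{R}$, $\mathcal{F}_\lambda$ is the space of smooth $\lambda$-densities $a\,(dx)^\lambda$ on $M$, with the $\mathrm{Vect}(M)$-action $L_X^\lambda(a\,(dx)^\lambda)=(Xa'+\lambda X'a)(dx)^\lambda$ for $X=X(x)\partial_x$. Multi-indices $\underline i=(i_1,\dots,i_m)$ have non-negative integer entries, $|\underline i|=\sum_j i_j$, and $\mathbf 1_j$ is the multi-index with $1$ in position $j$ and $0$ elsewhere. $\mathcal{D}^k_{\underline\lambda;\mu}$ is the space of $m$-ary differential operators of order $\le k$, $A=\sum_{|\underline i|\le k}a_{\underline i}\,\partial_{\underline i}:\mathcal{F}_{\lambda_1}\otimes\cdots\otimes\mathcal{F}_{\lambda_m}\to\mathcal{F}_\mu$, with $a_{\underline i}$ smooth functions on $M$ and $\partial_{\underline i}(\varphi_1,\dots,\varphi_m)=\varphi_1^{(i_1)}\cdots\varphi_m^{(i_m)}$. It is a $\mathrm{Vect}(M)$-module via $L_X^{\underline\lambda;\mu}(A)=L_X^\mu\circ A-\sum_{j=1}^m A(\dots,L_X^{\lambda_j}(-),\dots)$. $\mathcal{S}^{(j)}_{\lambda}$ is the direct sum of $\binom{j+m-1}{m-1}$ copies of $\mathcal{F}_\lambda$, indexed by the multi-indices $\underline i$ with $|\underline i|=j$. $\mathfrak{sl}(2)=\mathrm{Span}\{\partial_x,x\partial_x,x^2\partial_x\}\subset\mathrm{Vect}(M)$.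 The excluded set is $\{1,\frac32,2,\dots,k\}=\{\ell/2:\ \ell\in\mathbb{Z},\ 2\le\ell\le 2k\}$. A term $\alpha^{\underline s-\mathbf 1_j}_{\underline i}$ with $s_j=0$ has coefficient $0$ and is omitted. *)

(* Defs.v *)
From HB Require Import structures.
From mathcomp Require Import all_boot all_order all_algebra.
From mathcomp Require Import ring lra.
From mathcomp Require Import all_classical all_reals all_analysis.

Set Implicit Arguments.
Unset Strict Implicit.
Unset Printing Implicit Defensive.

Import Order.TTheory GRing.Theory Num.Theory.
Import numFieldNormedType.Exports.

Local Open Scope ring_scope.
Local Open Scope classical_set_scope.

Record smooth (R : realType) (f : R -> R) : Prop := Smooth {
  smooth_derivable_n : forall (n : nat) (x : R), derivable (f^`(n)) x 1 }.

Section SmoothTheory.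
Context {R : realType}.
Implicit Types f g : R -> R.

Lemma smooth_deriv f : smooth f -> smooth (f^`()).
Proof. by move=> [sf]; split=> n x; rewrite -derive1Sn; exact: sf. Qed.

Lemma smooth_derivn n f : smooth f -> smooth (f^`(n)).
Proof. by move=> sf; elim: n => [|n IHn]; [|exact (smooth_deriv IHn)]. Qed.

Lemma smooth_derivable f x : smooth f -> derivable f x 1.
Proof. by move=> [/(_ 0%N x)]. Qed.

Lemma smooth_coind (P : (R -> R) -> Prop) :
    (forall f, P f -> (forall x, derivable f x 1) /\ P (f^`())) ->
  forall f, P f -> smooth f.
Proof.
move=> HP f Pf; split=> n x; elim: n f Pf => [|n IHn] f /HP[df Pdf]; first exact: df.
by rewrite derive1Sn; exact: IHn.
Qed.

Lemma derive1_addfun f g : (forall x, derivable f x 1) -> (forall x, derivable g x 1) ->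
  (f \+ g)^`() = f^`() \+ g^`().
Proof. by move=> df dg; apply/funext => x /=; rewrite !derive1E deriveD. Qed.

Lemma derive1_mulfun f g : smooth f -> smooth g ->
  (f \* g)^`() = (f^`() \* g) \+ (f \* g^`()).
Proof.
move=> sf sg; apply/funext => x /=.
rewrite !derive1E deriveM; try exact: smooth_derivable.
by rewrite /GRing.scale/= addrC [X in X + _]mulrC.
Qed.

Lemma smooth_cst (c : R) : smooth (cst c : R -> R).
Proof.
apply: (@smooth_coind (fun f => exists c : R, f = cst c)); last by exists c.
move=> _ [d ->]; split=> [x|]; first exact: derivable_cst.
by exists 0; apply/funext => x; rewrite derive1_cst.
Qed.

Lemma derivable_mulfun f g x :
  derivable f x 1 -> derivable g x 1 -> derivable (f \* g) x 1.
Proof. by move=> df dg; have := derivableM df dg. Qed.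

Lemma derivable_addfun f g x :
  derivable f x 1 -> derivable g x 1 -> derivable (f \+ g) x 1.
Proof. by move=> df dg; have := derivableD df dg. Qed.

Inductive smooth_sum : (R -> R) -> Prop :=
| SmoothMul (f g : R -> R) of smooth f & smooth g : smooth_sum (f \* g)
| SmoothAdd (f g : R -> R) of smooth_sum f & smooth_sum g : smooth_sum (f \+ g).

Lemma smooth_sum_smooth f : smooth_sum f -> smooth f.
Proof.
apply: smooth_coind => {}f; elim=> {f} [f g sf sg|f g _ [df Pdf] _ [dg Pdg]].
  split=> [x|].
    by apply: derivable_mulfun; apply: smooth_derivable.
  rewrite (derive1_mulfun sf sg); apply: SmoothAdd.
    exact: SmoothMul (smooth_deriv sf) sg.
  exact: SmoothMul sf (smooth_deriv sg).
split=> [x|]; first by apply: derivable_addfun.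
by rewrite (derive1_addfun df dg); exact: SmoothAdd.
Qed.

Lemma smoothM f g : smooth f -> smooth g -> smooth (f \* g).
Proof. by move=> sf sg; apply: smooth_sum_smooth; exact: SmoothMul. Qed.

Lemma smoothD f g : smooth f -> smooth g -> smooth (f \+ g).
Proof.
have E (h : R -> R) : h = h \* cst 1 by apply/funext => x /=; rewrite mulr1.
move=> sf sg; rewrite (E f) (E g); apply: smooth_sum_smooth.
exact (SmoothAdd (SmoothMul sf (@smooth_cst 1)) (SmoothMul sg (@smooth_cst 1))).
Qed.

Lemma smooth_sumP (I : Type) (r : seq I) (P : pred I) (F : I -> R -> R) :
  (forall i, smooth (F i)) -> smooth (fun x => \sum_(i <- r | P i) F i x).
Proof.
move=> sF; elim: r => [|i r IHr].
  by under eq_fun do rewrite big_nil; exact: smooth_cst.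
under eq_fun do rewrite big_cons.
by case: (P i); [exact (smoothD (sF i) IHr)|].
Qed.
End SmoothTheory.

(* The line, and the circle seen as the real projective line with the affine
   coordinates x (chart true) and y = -1/x (chart false). *)
Inductive manifold : Set := Line | Circle.

Definition chart (M : manifold) : Type :=
  match M with Line => unit | Circle => bool end.

Definition affine (M : manifold) : chart M :=
  match M return chart M with Line => tt | Circle => true end.

(* Since dx = dy / y^2, the densities a(x) (dx)^lambda and b(y) (dy)^lambda
   agree on the overlap of the two charts of the circle iff
   b(y) = |y|^(-2 lambda) a(-1/y) for y <> 0. *)
Definition glued (R : realType) (M : manifold) (lambda : R) :
    (chart M -> R -> R) -> Prop :=
  match M return (chart M -> R -> R) -> Prop with
  | Line => fun=> True
  | Circle => fun a => forall y : R, y != 0 ->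
      a false y = `|y| `^ (- (2 * lambda)) * a true (- y^-1)
  end.

Section Densities.
Context {R : realType} (M : manifold).
Implicit Type lambda : R.

Definition is_density lambda : {pred chart M -> R -> R} :=
  [pred a | `[< (forall c, smooth (a c)) /\ glued lambda a >]].

Lemma is_density_submod lambda : submod_closed (is_density lambda).
Proof.
split=> [|c a b].
  apply/asboolP; split=> [c|]; first exact: smooth_cst.
  by case: M => //= y _; rewrite mulr0.
move=> /asboolP[sa ga] /asboolP[sb gb]; apply/asboolP; split=> [d|].
  by apply: smoothD => //; apply: (@smoothM _ (cst c)) => //; exact: smooth_cst.
move: a b ga gb {sa sb}; case: M => //= a b ga gb y y0.
rewrite !fctE ga // gb //= mulrDr; congr (_ + _).
by rewrite /GRing.scale/= mulrCA.
Qed.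

HB.instance Definition _ lambda :=
  GRing.isSubmodClosed.Build R (chart M -> R -> R) (is_density lambda)
    (is_density_submod lambda).

(* The module F_lambda of smooth lambda-densities on M. *)
Record density lambda : Type :=
  Density { density_fun :> chart M -> R -> R; _ : density_fun \in is_density lambda }.

HB.instance Definition _ lambda := [isSub for @density_fun lambda].
HB.instance Definition _ lambda := [Choice of density lambda by <:].
HB.instance Definition _ lambda :=
  [SubChoice_isSubLmodule of density lambda by <:].

(* A vector field X(x) d/dx is the density X(x) (dx)^(-1). *)
Definition vect : Type := density (-1 : R).

Definition lie_fun lambda (X a : chart M -> R -> R) : chart M -> R -> R :=
  fun c x => X c x * derive1 (a c) x + lambda * derive1 (X c) x * a c x.

End Densities.
Arguments is_density {R} M lambda.
Arguments density {R} M lambda.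
Arguments vect : clear implicits.
Section Gluing.
Context {R : realType}.
Implicit Types (lambda : R) (a b : R -> R).

Lemma glued_derive lambda a b (y : R) : y != 0 -> smooth b ->
    (forall y : R, y != 0 -> a y = `|y| `^ (- (2 * lambda)) * b (- y^-1)) ->
  derive1 a y = `|y| `^ (- (2 * lambda)) *
    (derive1 b (- y^-1) / y ^+ 2 - 2 * lambda / y * b (- y^-1)).
Proof.
move=> y0 sb ab; set e := - (2 * lambda).
have [s [s1 sn sy]] : exists s : R, [/\ s ^+ 2 = 1, `|s| = 1 & 0 < s * y].
  have [y_gt0|y_lt0|y00] := ltgtP 0 y; last by rewrite -y00 eqxx in y0.
    by exists 1; rewrite expr1n mul1r normr1.
  by exists (-1); rewrite sqrrN expr1n mulN1r oppr_gt0 normrN1.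
have nE (z : R) : 0 < s * z -> `|z| = s * z.
  by move=> sz; rewrite -[RHS]gtr0_norm // normrM sn mul1r.
have near_ab : \forall z \near y,
    ((fun z => (s * z) `^ e) * (b \o (fun z => - z^-1))) z = a z.
  have : \forall z \near y, 0 < s * z.
    have : (fun z => s * z) @ y --> s * y.
      by apply: cvgM; [exact: cvg_cst|exact: cvg_id].
    by move=> /cvgr_gt; apply.
  apply: filterS => z sz.
  have z0 : z != 0 by apply: contraTneq sz => ->; rewrite mulr0 ltxx.
  by rewrite ab // nE.
have ds : is_derive y 1 (fun z => s * z) s.
  have := @is_deriveZ R _ _ id s y 1 1 (is_derive_id _ _).
  by rewrite /GRing.scale/= mulr1.
have d1 : is_derive y 1 (fun z => (s * z) `^ e) ((e * (s * y) `^ (e - 1)) * s).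
  exact: (@is_derive1_comp R (fun z : R => z `^ e) (fun z => s * z) y _ _
           (is_derive1_powR e sy) ds).
have dv : is_derive y 1 (fun z : R => - z^-1) (y ^- 2).
  have := is_deriveN (is_deriveV y0 (is_derive_id y 1)).
  by rewrite scaleNr opprK /GRing.scale/= mulr1.
have d2 : is_derive y 1 (b \o (fun z => - z^-1)) (derive1 b (- y^-1) * y ^- 2).
  apply: is_derive1_comp; rewrite derive1E.
  by apply: derivableP; exact: smooth_derivable.
have [_ dE] := near_eq_is_derive near_ab (is_deriveM d1 d2).
rewrite derive1E dE /= nE // /GRing.scale/= powRB; last first.
  by rewrite (gt_eqF sy) implybT.
rewrite powRr1 ?ltW // /e.
have s0 : s != 0 by apply: contraTneq sy => ->; rewrite mul0r ltxx.
by field; rewrite y0 s0.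
Qed.

Lemma glued_lie M lambda (X a : chart M -> R -> R) :
    X \in is_density M (-1) -> a \in is_density M lambda ->
  lie_fun lambda X a \in is_density M lambda.
Proof.
move=> /asboolP[sX gX] /asboolP[sa ga]; apply/asboolP; split=> [c|].
  apply: (@smoothD _ (X c \* derive1 (a c))
    (((cst lambda) \* derive1 (X c)) \* (a c))).
    by apply: smoothM => //; exact: smooth_deriv.
  apply: smoothM => //; apply: smoothM; first exact: smooth_cst.
  exact: smooth_deriv.
move: X a sX gX sa ga; case: M => //= X a sX gX sa ga y y0.
rewrite /lie_fun (glued_derive y0 (sX true) gX) (glued_derive y0 (sa true) ga).
rewrite gX // ga //.
have -> : `|y| `^ (- (2 * -1)) = y ^+ 2.
  by rewrite mulrN1 opprK powR_mulrn // -normrX ger0_norm // sqr_ge0.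
by field.
Qed.
End Gluing.

Section Modules.
Context {R : realType} {M : manifold}.

Definition lie (lambda : R) (X : vect R M) (a : density M lambda) :
    density M lambda :=
  Density (glued_lie (valP X) (valP a)).

(* sl(2) = Span {d/dx, x d/dx, x^2 d/dx} *)
Definition sl2 (X : vect R M) : Prop :=
  exists c0 c1 c2 : R, forall x,
    X (affine M) x = c0 + c1 * x + c2 * x ^+ 2.

Lemma sl2_exists (c0 c1 c2 : R) :
  exists X : vect R M, forall x, X (affine M) x = c0 + c1 * x + c2 * x ^+ 2.
Proof.
pose q (a b c : R) := cst a \+ (cst b \* id) \+ (cst c \* (id \* id)).
have sid : smooth (id : R -> R).
  apply: (@smooth_coind _ (fun f => f = id \/ exists c : R, f = cst c)).
    move=> _ [->|[c ->]]; split=> [x|]; first exact: derivable_id.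
    - by right; exists 1; apply/funext => x; exact: derive1_id.
    - exact: derivable_cst.
    - by right; exists 0; apply/funext => x; exact: derive1_cst.
  by left.
have sq a b c : smooth (q a b c).
  by do 2?[apply: smoothD]; repeat apply: smoothM => //; exact: smooth_cst.
pose Y (d : chart M) : R -> R :=
  match M return chart M -> R -> R with
  | Line => fun=> q c0 c1 c2
  | Circle => fun b => if b then q c0 c1 c2 else q c2 (- c1) c0
  end d.
have YP : Y \in is_density M (-1).
  apply/asboolP; rewrite /Y; case: M => /=; split=> //; first by case.
  move=> y y0; have -> : `|y| `^ (- (2 * -1)) = y ^+ 2.
    by rewrite mulrN1 opprK powR_mulrn // -normrX ger0_norm // sqr_ge0.
  by rewrite /q /=; field.
by exists (Density YP) => x; rewrite /= /Y; case: M => /=; rewrite expr2.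
Qed.

End Modules.

(* The multi-indices i = (i_1, ..., i_m) with |i| <= k. *)
Record mindex (m k : nat) : Type := MIndex {
  mindex_fun :> {ffun 'I_m -> 'I_k.+1};
  mindex_le : (\sum_j mindex_fun j <= k)%N }.

HB.instance Definition _ m k := [isSub for @mindex_fun m k].
HB.instance Definition _ m k := [Finite of mindex m k by <:].

Section MultiIndices.
Context {m k : nat}.

Definition mdeg (s : mindex m k) : nat := \sum_j s j.

Fact lower_le (j : 'I_m) (s : mindex m k) :
  (\sum_l [ffun l => if l == j then inord (s l).-1 else s l : 'I_k.+1] l <= k)%N.
Proof.
apply: leq_trans (mindex_le s); apply: leq_sum => l _; rewrite ffunE.
case: eqP => // _; rewrite inordK ?leq_pred //.
by apply: leq_ltn_trans (ltn_ord (s l)); exact: leq_pred.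
Qed.

(* s - 1_j, the j-th entry being left unchanged when it is 0 *)
Definition lower (j : 'I_m) (s : mindex m k) : mindex m k :=
  MIndex (lower_le j s).

End MultiIndices.

Definition layer (m k p : nat) : Type := {s : mindex m k | mdeg s == p}.

HB.instance Definition _ m k p := SubFinite.on (layer m k p).


Section Operators.
Context {R : realType} {M : manifold} {m k : nat}.
Variables (lambda : 'I_m -> R) (mu : R).

Definition multiop : Type :=
  (forall j, density M (lambda j)) -> density M mu.

HB.instance Definition _ := GRing.Lmodule.on multiop.

(* A = \sum_i a_i \partial_i in the coordinate of the chart c *)
Definition expresses (c : chart M) (a : mindex m k -> R -> R) (A : multiop) :
    Prop :=
  (forall s, smooth (a s)) /\
  forall (phi : forall j, density M (lambda j)) (x : R),
    A phi c x = \sum_s a s x * \prod_j derive1n (s j) (phi j c) x.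

Definition is_diffop : {pred multiop} :=
  [pred A | `[< forall c : chart M, exists a, expresses c a A >]].

Lemma is_diffop_submod : submod_closed is_diffop.
Proof.
split=> [|t A B /asboolP dA /asboolP dB]; apply/asboolP => c.
  exists (fun=> cst 0); split=> [s|phi x]; first exact: smooth_cst.
  by rewrite big1 // => s _; rewrite mul0r.
have [a [sa aE]] := dA c; have [b [sb bE]] := dB c.
exists (fun s x => t * a s x + b s x); split=> [s|phi x].
  by apply: smoothD => //; apply: (@smoothM _ (cst t)) => //; exact: smooth_cst.
under eq_bigr do rewrite mulrDl -mulrA.
by rewrite big_split/= -mulr_sumr -aE -bE.
Qed.

HB.instance Definition _ :=
  GRing.isSubmodClosed.Build R multiop is_diffop is_diffop_submod.

(* D^k_{lambda; mu} *)
Record diffop : Type := Diffop { diffop_fun :> multiop; _ : diffop_fun \in is_diffop }.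

HB.instance Definition _ := [isSub for diffop_fun].
HB.instance Definition _ := [Choice of diffop by <:].
HB.instance Definition _ := [SubChoice_isSubLmodule of diffop by <:].

Definition lie_multiop (X : vect R M) (A : multiop) : multiop := fun phi =>
  lie X (A phi) - \sum_j A (eqtype.dfwith phi (lie X (phi j))).

End Operators.
Arguments multiop {R} M {m} lambda mu.
Arguments is_diffop {R} M {m} k lambda mu.
Arguments diffop {R} M {m} k lambda mu.

Section LieDiffop.
Context {R : realType} {M : manifold} {m k : nat}.
Variables (lambda : 'I_m -> R) (mu : R) (X : vect R M).

Definition upd (i : 'I_m -> nat) (j : 'I_m) (n : nat) : 'I_m -> nat :=
  fun l => if l == j then n else i l.

Definition monom (f : 'I_m -> R -> R) (i : 'I_m -> nat) (x : R) : R :=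
  \prod_l derive1n (i l) (f l) x.

Lemma density_smooth t (a : density M t) (c : chart M) : @smooth R (a c).
Proof. by case: a => a Pa; have /asboolP[+ _] := Pa. Qed.

Lemma monomE f i j x :
  monom f i x = derive1n (i j) (f j) x * \prod_(l | l != j) derive1n (i l) (f l) x.
Proof. by rewrite /monom (bigD1 j). Qed.

Lemma monom_upd f i j n x :
  monom f (upd i j n) x =
  derive1n n (f j) x * \prod_(l | l != j) derive1n (i l) (f l) x.
Proof.
rewrite (monomE _ _ j) /upd eqxx; congr (_ * _).
by apply: eq_bigr => l /negbTE ->.
Qed.

Lemma derive_prod (I : eqType) (r : seq I) (f : I -> R -> R) x :
    uniq r -> (forall i, smooth (f i)) ->
  smooth (fun x => \prod_(i <- r) f i x) /\
  derive1 (fun x => \prod_(i <- r) f i x) x =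
  \sum_(j <- r) \prod_(l <- r) (if l == j then derive1 (f l) else f l) x.
Proof.
move=> + sf; elim: r => [_|i r IHr /= /andP[ir ur]].
  under eq_fun do rewrite big_nil; rewrite big_nil.
  by split; [exact: smooth_cst|rewrite derive1_cst].
have {IHr ur}[sr dr] := IHr ur.
have E : (fun x => \prod_(l <- i :: r) f l x) = f i \* (fun x => \prod_(l <- r) f l x).
  by apply/funext => z; rewrite big_cons.
rewrite E; split; first exact: smoothM.
rewrite derive1_mulfun //= dr big_cons big_cons eqxx; congr (_ * _ + _).
  by apply: eq_big_seq => l lr; case: eqP => // li; rewrite -li lr in ir.
rewrite mulr_sumr; apply: eq_big_seq => j jr; rewrite big_cons.
by case: eqP => // ij; rewrite ij jr in ir.
Qed.

Lemma derive_monom f i x : (forall j, smooth (f j)) ->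
  smooth (monom f i) /\
  derive1 (monom f i) x = \sum_j monom f (upd i j (i j).+1) x.
Proof.
move=> sf; have sg j : smooth (derive1n (i j) (f j)) by exact: smooth_derivn.
have [sm ->] := @derive_prod _ (index_enum 'I_m) _ x (index_enum_uniq _) sg.
split=> //; apply: eq_bigr => j _; rewrite monom_upd (bigD1 j) //= eqxx.
by congr (_ * _); apply: eq_bigr => l /negbTE ->.
Qed.

Lemma lie_derivn (t : R) (n : nat) (c : chart M) :
  exists g : 'I_n.+1 -> R -> R, (forall l, smooth (g l)) /\
  forall (a : density M t) x,
    derive1n n (lie X a c) x = X c x * derive1n n.+1 (a c) x +
      \sum_l g l x * derive1n l (a c) x.
Proof.
have sX : @smooth R (X c) by exact: density_smooth.
elim: n => [|n [g [sg gE]]].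
  exists (fun _ x => t * derive1 (X c) x); split=> [_|a x].
    by apply: (@smoothM _ (cst t)); [exact: smooth_cst|exact: smooth_deriv].
  by rewrite big_ord1.
pose g' (l : 'I_n.+2) (x : R) : R :=
  (l == n.+1 :> nat)%:R * derive1 (X c) x +
  (if unlift ord_max l is Some l' then derive1 (g l') x else 0) +
  (if unlift ord0 l is Some l' then g l' x else 0).
exists g'; split=> [l|a x].
  apply: smoothD; last first.
    by case: unliftP => [l'|] _; [exact: sg|exact: smooth_cst].
  apply: smoothD; first by apply: (@smoothM _ (cst _)) => //;
    [exact: smooth_cst|exact: smooth_deriv].
  by case: unliftP => [l'|] _; [exact/smooth_deriv/sg|exact: smooth_cst].
have sa : @smooth R (a c) by exact: density_smooth.
have sm l : smooth (g l \* derive1n l (a c)).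
  by apply: smoothM => //; exact: smooth_derivn.
rewrite [derive1n n.+1 (lie X a c)]/=.
have -> : derive1n n (lie X a c) = (X c \* derive1n n.+1 (a c)) \+
    (fun x => \sum_l (g l \* derive1n l (a c)) x).
  by apply/funext => z; rewrite gE.
have dsum (r : seq 'I_n.+1) :
    derive1 (fun x => \sum_(l <- r) (g l \* derive1n l (a c)) x) x =
    \sum_(l <- r) (derive1 (g l) x * derive1n l (a c) x
                   + g l x * derive1n l.+1 (a c) x).
  elim: r => [|l r IHr].
    by under eq_fun do rewrite big_nil; rewrite derive1_cst big_nil.
  under eq_fun do rewrite big_cons.
  rewrite derive1_addfun; last 2 first.
  - by move=> z; exact: smooth_derivable.
  - by move=> z; apply: smooth_derivable; apply: smooth_sumP.
  by rewrite /= IHr big_cons derive1_mulfun //; exact: smooth_derivn.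
have sn p : smooth (derive1n p (a c)) by exact: smooth_derivn.
rewrite derive1_addfun; last 2 first.
- by move=> z; apply: smooth_derivable; exact: smoothM.
- by move=> z; apply: smooth_derivable; apply: smooth_sumP.
rewrite /= dsum (derive1_mulfun sX (sn n.+1)) /= addrAC addrC; congr (_ + _).
rewrite big_split /g' /=.
under [RHS]eq_bigr do rewrite !mulrDl.
rewrite !big_split/= -addrA; congr (_ + _); last congr (_ + _).
- rewrite (bigD1 ord_max) //= eqxx mul1r big1 ?addr0 // => l lm.
  by rewrite (_ : (_ == _) = false) ?mul0r //; apply: contraNF lm.
- rewrite [RHS]big_ord_recr/= unlift_none mul0r addr0.
  apply: eq_bigr => l _; have -> : widen_ord (leqnSn n.+1) l = lift ord_max l.
    by apply: val_inj; rewrite /= /bump leqNgt ltn_ord.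
  by rewrite liftK.
- rewrite [RHS]big_ord_recl/= unlift_none mul0r add0r.
  by apply: eq_bigr => l _; rewrite liftK.
Qed.

(* P is a combination of the monomials of degree <= k with smooth coefficients *)
Definition expressible (c : chart M)
    (P : (forall j, density M (lambda j)) -> R -> R) : Prop :=
  exists a : mindex m k -> R -> R, (forall s, smooth (a s)) /\
    forall phi x, P phi x =
      \sum_s a s x * monom (fun j => phi j c) (fun j => s j) x.

Lemma expressible0 c : expressible c (fun _ _ => 0).
Proof.
exists (fun=> cst 0); split=> [s|phi x]; first exact: smooth_cst.
by rewrite big1 // => s _; rewrite mul0r.
Qed.

Lemma expressibleD c P Q : expressible c P -> expressible c Q ->
  expressible c (fun phi x => P phi x + Q phi x).
Proof.
move=> [a [sa aE]] [b [sb bE]].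
exists (fun s => a s \+ b s); split=> [s|phi x]; first exact: smoothD.
by under eq_bigr do rewrite /= mulrDl; rewrite big_split /= aE bE.
Qed.

Lemma expressible_sum c (I : Type) (r : seq I) P :
    (forall i : I, expressible c (P i)) ->
  expressible c (fun phi x => \sum_(i <- r) P i phi x).
Proof.
move=> eP; elim: r => [|i r IHr].
  by under eq_fun do under eq_fun do rewrite big_nil; exact: expressible0.
under eq_fun do under eq_fun do rewrite big_cons.
exact: expressibleD.
Qed.

Lemma expressible_monom c (g : R -> R) (i : 'I_m -> nat) :
    smooth g -> (\sum_j i j <= k)%N ->
  expressible c (fun phi x => g x * monom (fun j => phi j c) i x).
Proof.
move=> sg ik.
have ij j : (i j < k.+1)%N.
  by rewrite ltnS; apply: leq_trans ik; rewrite (bigD1 j) //= leq_addr.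
have sk : (\sum_j [ffun j => Ordinal (ij j)] j <= k)%N.
  by under eq_bigr do rewrite ffunE.
pose s0 := MIndex sk.
exists (fun s => if s == s0 then g else cst 0); split=> [s|phi x].
  by case: ifP => // _; exact: smooth_cst.
rewrite (bigD1 s0) //= eqxx big1 ?addr0 => [|s /negbTE ->]; last by rewrite mul0r.
by congr (_ * _); apply: eq_bigr => j _; rewrite ffunE.
Qed.

Lemma lie_multiop_diffop (A : multiop M lambda mu) :
  A \in is_diffop M k lambda mu -> lie_multiop X A \in is_diffop M k lambda mu.
Proof.
move=> /asboolP dA; apply/asboolP => c.
have [a [sa aE]] := dA c.
have sX : @smooth R (X c) by exact: density_smooth.
have /choice[g gP] : forall j : 'I_m, exists g : nat -> nat -> R -> R,
    (forall n l, smooth (g n l)) /\ forall n (b : density M (lambda j)) x,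
    derive1n n (lie X b c) x = X c x * derive1n n.+1 (b c) x +
      \sum_(l < n.+1) g n l x * derive1n l (b c) x.
  move=> j; have /all_sig[g gP] := fun n => cid (lie_derivn (lambda j) n c).
  exists (fun n l => if insub l is Some l' then g n l' else cst 0).
  split=> [n l|n b x].
    by case: insubP => [l' _ _|_]; [case: (gP n)|exact: smooth_cst].
  have [_ ->] := gP n; congr (_ + _); apply: eq_bigr => l _.
  by rewrite valK.
suff : expressible c (fun phi x => lie_multiop X A phi c x).
  by move=> [b [sb bE]]; exists b; split.
pose P (s : mindex m k) (phi : forall j, density M (lambda j)) (x : R) : R :=
  (X c x * derive1 (a s) x + mu * derive1 (X c) x * a s x) *
    monom (fun j => phi j c) (fun j => s j) x +
  \sum_j \sum_(l < (s j).+1) - (a s x * g j (s j) l x) *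
    monom (fun j => phi j c) (upd (fun j => s j) j l) x.
have -> : (fun phi x => lie_multiop X A phi c x) =
          (fun phi x => \sum_s P s phi x).
  apply/funext => phi; apply/funext => x.
  pose f j := phi j c.
  have sf j : smooth (f j) by exact: density_smooth.
  have valE : lie_multiop X A phi c x = lie X (A phi) c x -
      \sum_j A (eqtype.dfwith phi (lie X (phi j))) c x.
    have vB (u v : density M mu) : (u - v) c x = u c x - v c x by [].
    have vS (r : seq 'I_m) (B : 'I_m -> density M mu) :
        (\sum_(j <- r) B j) c x = \sum_(j <- r) B j c x.
      by elim/big_rec2: _ => // j u v _ <-.
    by rewrite /lie_multiop vB vS.
  rewrite {}valE /= /lie_fun.
  have AE : A phi c = fun x => \sum_s (a s \* monom f (fun j => s j)) x.
    by apply/funext => z; rewrite aE.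
  have sm s : smooth (monom f (fun j => s j)).
    by have [] := derive_monom (fun j => s j) x sf.
  have -> : derive1 (A phi c) x = \sum_s (derive1 (a s) x *
      monom f (fun j => s j) x + a s x *
      \sum_j monom f (upd (fun j => s j) j (s j).+1) x).
    rewrite AE; elim: (index_enum _) => [|s r IHr].
      by under eq_fun do rewrite big_nil; rewrite derive1_cst big_nil.
    under eq_fun do rewrite big_cons.
    rewrite derive1_addfun; last 2 first.
    - by move=> z; apply: smooth_derivable; exact: smoothM.
    - move=> z; apply: smooth_derivable; apply: smooth_sumP => s'.
      exact: smoothM.
    rewrite /= IHr big_cons derive1_mulfun //=; congr (_ + _ * _ + _).
    by have [_] := derive_monom (fun j => s j) x sf.
  rewrite AE !mulr_sumr.
  under [X in _ - X]eq_bigr => j _ do rewrite aE.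
  rewrite exchange_big /= -big_split -sumrB /=; apply: eq_bigr => s _.
  have dfE j : \prod_l derive1n (s l)
        (eqtype.dfwith phi (lie X (phi j)) l c) x =
      X c x * monom f (upd (fun j => s j) j (s j).+1) x +
      \sum_(l < (s j).+1) g j (s j) l x * monom f (upd (fun j => s j) j l) x.
    pose Q := \prod_(l | l != j) derive1n (s l) (f l) x.
    have mE n : monom f (upd (fun j => s j) j n) x = derive1n n (f j) x * Q.
      exact: monom_upd.
    have -> : \prod_l derive1n (s l)
        (eqtype.dfwith phi (lie X (phi j)) l c) x =
        derive1n (s j) (lie X (phi j) c) x * Q.
      rewrite (bigD1 j) //=; congr (_ * _); first by rewrite eqtype.dfwith_in.
      by apply: eq_bigr => l lj; rewrite eqtype.dfwith_out // eq_sym.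
    have [_ ->] := gP j; rewrite mE mulrDl -mulrA; congr (_ + _).
    by rewrite mulr_suml; apply: eq_bigr => l _; rewrite mE mulrA.
  rewrite [X in _ - X](eq_bigr (fun j => X c x * (a s x *
      monom f (upd (fun j => s j) j (s j).+1) x) + a s x *
      \sum_(l < (s j).+1) g j (s j) l x * monom f (upd (fun j => s j) j l) x));
    last by move=> j _; rewrite dfE mulrDr mulrCA.
  rewrite big_split /= -!mulr_sumr /P -/f.
  rewrite [X in _ = _ + X](eq_bigr (fun j => - (a s x * \sum_(l < (s j).+1) g j (s j) l x *
      monom f (upd (fun j => s j) j l) x))); last first.
    move=> j _; rewrite mulr_sumr -sumrN; apply: eq_bigr => l _; ring.
  rewrite sumrN -mulr_sumr; ring.
apply: expressible_sum => s; apply: expressibleD.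
  apply: expressible_monom; last exact: mindex_le.
  apply: smoothD; first by apply: smoothM => //; exact: smooth_deriv.
  apply: smoothM => //; apply: smoothM; first exact: smooth_cst.
  exact: smooth_deriv.
apply: expressible_sum => j; apply: expressible_sum => l.
apply: expressible_monom.
  have -> : (fun x => - (a s x * g j (s j) l x)) =
      (cst (-1) \* (a s \* g j (s j) l)).
    by apply/funext => x /=; rewrite mulN1r.
  apply: smoothM; first exact: smooth_cst.
  by apply: smoothM => //; exact: (gP j).1.
apply: leq_trans (mindex_le s); apply: leq_sum => i _; rewrite /upd.
by case: eqP => // ->; rewrite -ltnS.
Qed.

End LieDiffop.
Section LieAction.
Context {R : realType} {M : manifold} {m k : nat}.
Variables (lambda : 'I_m -> R) (mu : R).

Definition lie_diffop (X : vect R M) (A : diffop M k lambda mu) :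
    diffop M k lambda mu :=
  Diffop (lie_multiop_diffop X (valP A)).

End LieAction.

Definition dirsum (R : realType) (I : Type) (V : I -> lmodType R) : Type :=
  forall i, V i.

Section DirectSum.
Context {R : realType} {I : Type} (V : I -> lmodType R).

HB.instance Definition _ := gen_eqMixin (dirsum V).
HB.instance Definition _ := gen_choiceMixin (dirsum V).

Let zero : dirsum V := fun=> 0.
Let opp (u : dirsum V) : dirsum V := fun i => - u i.
Let add (u v : dirsum V) : dirsum V := fun i => u i + v i.
Let scale (a : R) (u : dirsum V) : dirsum V := fun i => a *: u i.

Fact dirsum_addA : associative add.
Proof. by move=> u v w; apply: functional_extensionality_dep => i; exact: addrA. Qed.
Fact dirsum_addC : commutative add.
Proof. by move=> u v; apply: functional_extensionality_dep => i; exact: addrC. Qed.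
Fact dirsum_add0 : left_id zero add.
Proof. by move=> u; apply: functional_extensionality_dep => i; exact: add0r. Qed.
Fact dirsum_addN : left_inverse zero opp add.
Proof. by move=> u; apply: functional_extensionality_dep => i; exact: addNr. Qed.

HB.instance Definition _ := GRing.isZmodule.Build (dirsum V)
  dirsum_addA dirsum_addC dirsum_add0 dirsum_addN.

Fact dirsum_scaleA a b (u : dirsum V) : scale a (scale b u) = scale (a * b) u.
Proof. by apply: functional_extensionality_dep => i; exact: scalerA. Qed.
Fact dirsum_scale1 : left_id 1 scale.
Proof. by move=> u; apply: functional_extensionality_dep => i; exact: scale1r. Qed.
Fact dirsum_scaleDr : right_distributive scale +%R.
Proof. by move=> a u v; apply: functional_extensionality_dep => i; exact: scalerDr. Qed.
Fact dirsum_scaleDl u : {morph scale^~ u : a b / a + b}.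
Proof. by move=> a b; apply: functional_extensionality_dep => i; exact: scalerDl. Qed.

HB.instance Definition _ := GRing.Zmodule_isLmodule.Build R (dirsum V)
  dirsum_scaleA dirsum_scale1 dirsum_scaleDr dirsum_scaleDl.

End DirectSum.

Section Symbols.
Context {R : realType} (M : manifold) (m k : nat).

(* S^(j)_t: one copy of F_t for every multi-index of length j *)
Definition symb (j : nat) (t : R) : Type := layer m k j -> density M t.

HB.instance Definition _ j t := GRing.Lmodule.on (symb j t).

Definition symbols (delta : R) : Type :=
  dirsum (fun j : 'I_k.+1 => symb j (delta - j%:R) : lmodType R).

HB.instance Definition _ delta := GRing.Lmodule.on (symbols delta).

Definition lie_symbols (delta : R) (X : vect R M) (P : symbols delta) :
    symbols delta :=
  fun j i => lie X (P j i).

End Symbols.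

Section Coefficients.
Context {R : realType} {M : manifold} {m k : nat}.
Implicit Type alpha : mindex m k -> mindex m k -> R.

(* [alpha s i] stands for the constant alpha^s_i. *)
Definition extends (alpha0 : forall p : 'I_k.+1, 'M[R]_#|{: layer m k p}|)
    alpha : Prop :=
  forall (p : 'I_k.+1) (s i : layer m k p),
    alpha (val s) (val i) = alpha0 p (enum_rank s) (enum_rank i).

Definition induction_formula (lambda : 'I_m -> R) (delta : R) alpha : Prop :=
  forall s i : mindex m k, (mdeg i < mdeg s)%N ->
    ((mdeg s)%:R - (mdeg i)%:R)
      * (2 * delta - (mdeg s)%:R - (mdeg i)%:R - 1) * alpha s i
    - \sum_(j | (0 < s j)%N)
        (s j)%:R * (2 * lambda j + (s j)%:R - 1) * alpha (lower j s) i = 0.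

(* In the affine coordinate, sigma maps the operator \sum_s a_s \partial_s to
   the symbol whose component of index i is
   \sum_(|i| <= |s| <= k) alpha^s_i a_s^(|s| - |i|). *)
Definition given_by alpha (lambda : 'I_m -> R) (mu delta : R)
    (sigma : diffop M k lambda mu -> symbols M m k delta) : Prop :=
  forall (A : diffop M k lambda mu) (a : mindex m k -> R -> R),
    expresses (affine M) a A ->
    forall (r : 'I_k.+1) (i : layer m k r) (x : R),
      sigma A r i (affine M) x =
      \sum_(s | (r <= mdeg s)%N)
        alpha s (val i) * derive1n (mdeg s - r) (a s) x.

Definition sl2_equivariant (lambda : 'I_m -> R) (mu delta : R)
    (sigma : diffop M k lambda mu -> symbols M m k delta) : Prop :=
  forall X : vect R M, sl2 X -> forall A : diffop M k lambda mu,
    sigma (lie_diffop X A) = lie_symbols X (sigma A).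

End Coefficients.

(* Main.v *)
(* Write q n = n (2 delta - 1 - n) and let N be the lowering matrix
   N s t = \sum_(j : s - 1_j = t) s_j (2 lambda_j + s_j - 1). The induction
   formula says that alpha intertwines N with the diagonal matrix q; it is solved
   by recursion on |s| since q is injective on degrees off the resonances, and it
   is equivariance under x^2 d/dx: for X quadratic, L_X acts on the coefficients
   a_s as on densities of weight delta - |s|, plus the term -(X''/2) \sum_t N t s a_t.

   On the circle one must also see that the symbol of a global operator is glued
   along y = -1/x. Let beta be the solution of the transposed recursion which is
   the identity on the diagonal. For fixed i, the transvectant
   \sum_s beta_(s,i) u^(|i| - |s|) \prod_j phi_j^(s_j) is killed by x^2 d/dx, hence
   by the flow that describes the action of the inversion on jets, so it is
   covariant under the inversion. Every operator is a sum of transvectants of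
   unique u_i, so the u_i are glued; finally alpha * beta commutes with q, hence is
   block diagonal, so that the symbols are linear combinations of the u_j with
   |j| = |i|. *)
Require Import Defs.
From HB Require Import structures.
From mathcomp Require Import all_boot all_order all_algebra.
From mathcomp Require Import ring lra zify.
From mathcomp Require Import all_classical all_reals all_analysis.

Set Implicit Arguments.
Unset Strict Implicit.
Unset Printing Implicit Defensive.

Import Order.TTheory GRing.Theory Num.Theory.
Import numFieldNormedType.Exports.

Local Open Scope ring_scope.

(** * Linear systems triangular for a degree function *)

Section TriangularSystem.
Context {F : fieldType} {I : finType}.
Variables (d : I -> nat) (q : I -> F) (K : I -> I -> F).
Hypothesis q_inj : forall s i, q s = q i <-> d s = d i.
Hypothesis K_deg : forall s t, K s t != 0 -> d s = (d t).+1.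

(** Recursion on [d s]: row [s] only involves indices [t] of degree [d s - 1], and [q s - q i] is
    invertible once [d s > d i]. For [d s <= d i] both sides of the equation vanish. *)
Lemma triangular_solution (B : I -> I -> F) :
  exists a : I -> I -> F, [/\ forall s i, d s = d i -> a s i = B s i,
    forall s i, (d s < d i)%N -> a s i = 0 &
    forall s i, (q s - q i) * a s i = \sum_t K s t * a t i].
Proof.
(* The fuel [n] starts at [d s] and drops with the degree, so the last default 0 is never reached
   when [d s > d i]. *)
pose fix a n s i {struct n} : F := if d s == d i then B s i else if (d s < d i)%N then 0 else
  if n is n'.+1 then (\sum_t K s t * a n' t i) / (q s - q i) else 0.
have aE n s i : a n s i = if d s == d i then B s i else
    if (d s < d i)%N then 0 else
    if n is n'.+1 then (\sum_t K s t * a n' t i) / (q s - q i) else 0.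
  by case: n.
exists (fun s i => a (d s) s i); split=> s i.
- by move=> dE; rewrite aE dE eqxx.
- by move=> dE; rewrite aE ltn_eqF // dE.
have [dsi|dis|/esym dE] := ltngtP (d s) (d i).
- rewrite aE ltn_eqF // dsi mulr0 big1 // => t _.
  have [->|Kst] := eqVneq (K s t) 0; first by rewrite mul0r.
  have dt := K_deg Kst; have lt_ti : (d t < d i)%N by rewrite (leq_trans _ dsi) // dt ltnW.
  by rewrite aE ltn_eqF // lt_ti mulr0.
- have q0 : q s - q i != 0.
    by rewrite subr_eq0; apply/eqP => /q_inj dE; rewrite dE ltnn in dis.
  rewrite aE gtn_eqF // ltnNge ltnW //=.
  case dsE : (d s) dis => [//|n] _; rewrite mulrC divfK //; apply: eq_bigr => t _.
  have [->|Kst] := eqVneq (K s t) 0; first by rewrite !mul0r.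
  by have := K_deg Kst; rewrite dsE => -[->].
- have -> : q s = q i by apply/q_inj.
  rewrite subrr mul0r big1 // => t _.
  have [->|Kst] := eqVneq (K s t) 0; first by rewrite mul0r.
  have lt_ti : (d t < d i)%N by rewrite dE (K_deg Kst).
  by rewrite aE ltn_eqF // lt_ti mulr0.
Qed.

(** Only rows with [d i < d s] are constrained, as in the induction formula. The induction stays in
    the range [d i <= d s] because [K] lowers the degree by exactly one. *)
Lemma triangular_uniq (a b : I -> I -> F) :
    (forall s i, (d i < d s)%N -> (q s - q i) * a s i = \sum_t K s t * a t i) ->
    (forall s i, (d i < d s)%N -> (q s - q i) * b s i = \sum_t K s t * b t i) ->
    (forall s i, d s = d i -> b s i = a s i) ->
  forall s i, (d i <= d s)%N -> b s i = a s i.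
Proof.
move=> sa sb ab s i; move: {2}(d s) (leqnn (d s)) => n.
elim: n s => [|n IHn] s sn; rewrite leq_eqVlt => /predU1P[/esym/ab //|lt_is].
  by move: sn lt_is; rewrite leqn0 => /eqP ->.
have q0 : q s - q i != 0.
  by rewrite subr_eq0; apply/eqP => /q_inj dE; rewrite dE ltnn in lt_is.
apply: (mulfI q0); rewrite sa // sb //; apply: eq_bigr => t _.
have [->|Kst] := eqVneq (K s t) 0; first by rewrite !mul0r.
have dE := K_deg Kst; rewrite IHn //; first by rewrite -ltnS -dE.
by rewrite -ltnS -dE.
Qed.

(* Both a and b intertwine K with the diagonal matrix q, hence their product
   commutes with q. *)
Lemma triangular_dual (a b : I -> I -> F) :
    (forall s i, (q s - q i) * a s i = \sum_t K s t * a t i) ->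
    (forall s i, (q s - q i) * b s i = \sum_t K t s * b t i) ->
    (forall s i, (d s < d i)%N -> a s i = 0) ->
    (forall s i, (d i < d s)%N -> b s i = 0) ->
    (forall s i, d s = d i -> b s i = (s == i)%:R) ->
  forall i j, \sum_s a s i * b s j = if d i == d j then a j i else 0.
Proof.
move=> aE bE a0 b0 b1 i j; case: ifPn => [/eqP dE|dij]; last first.
  have q0 : q j - q i != 0.
    by rewrite subr_eq0; apply: contra dij => /eqP/q_inj ->.
  have E s : (q j - q i) * (a s i * b s j) =
      (q s - q i) * a s i * b s j - a s i * ((q s - q j) * b s j) by ring.
  apply: (mulfI q0); rewrite mulr0 mulr_sumr; under eq_bigr do rewrite E.
  rewrite sumrB; under eq_bigr do rewrite aE mulr_suml.
  under [X in _ - X]eq_bigr do rewrite bE mulr_sumr.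
  rewrite exchange_big /= -sumrB big1 // => s _.
  rewrite -sumrB big1 // => t _; ring.
(* In equal degrees only [s = j] survives: [a s i] vanishes below the common degree, [b s j] above
   it, and [b] is the identity at that degree. *)
rewrite (bigD1 j) //= b1 // eqxx mulr1 big1 ?addr0 // => s sj.
have [ds|ds|ds] := ltngtP (d s) (d j).
- by rewrite a0 ?mul0r // dE.
- by rewrite b0 ?mulr0.
- by rewrite b1 // (negbTE sj) mulr0.
Qed.

End TriangularSystem.

(** A one-sided inverse of a square matrix is two-sided; here [b] is a right inverse of the
    transpose of [a]. *)
Lemma left_inverse_sum (F : fieldType) (I : finType) (a b : I -> I -> F) :
    (forall i j, \sum_s a s i * b s j = (i == j)%:R) ->
  forall s t, \sum_i b s i * a t i = (s == t)%:R.
Proof.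
move=> ab s t; pose n := #|I|.
pose A : 'M[F]_n := \matrix_(i, s) a (enum_val s) (enum_val i).
pose B : 'M[F]_n := \matrix_(s, j) b (enum_val s) (enum_val j).
have /mulmx1C/matrixP/(_ (enum_rank s) (enum_rank t)) : A *m B = 1%:M.
  apply/matrixP => i j; rewrite !mxE -(inj_eq enum_val_inj) -ab.
  rewrite [RHS](reindex _ (onW_bij _ (enum_val_bij I))).
  by apply: eq_bigr => r _; rewrite !mxE.
rewrite !mxE (inj_eq enum_rank_inj) => <-.
rewrite (reindex _ (onW_bij _ (enum_val_bij I))).
by apply: eq_bigr => r _; rewrite !mxE !enum_rankK.
Qed.

(** * The diagonal matrix and the lowering matrix on multi-indices *)

Section MultiIndexKernel.
Context {R : realType} {m k : nat}.
Variables (lambda : 'I_m -> R) (delta : R).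
Implicit Types s t i : mindex m k.

Lemma mdeg_le s : (mdeg s <= k)%N. Proof. exact: mindex_le. Qed.

Lemma lowerE j s l : lower j s l = (if l == j then (s l).-1 else s l) :> nat.
Proof.
rewrite /lower /= ffunE; case: eqP => // _; rewrite inordK //.
by apply: leq_ltn_trans (ltn_ord (s l)); exact: leq_pred.
Qed.

Lemma mdeg_lower j s : (0 < s j)%N -> mdeg s = (mdeg (lower j s)).+1.
Proof.
move=> sj; rewrite /mdeg (bigD1 j) //= [in RHS](bigD1 j) //= lowerE eqxx.
rewrite -addSn prednK //; congr (_ + _)%N; apply: eq_bigr => l /negbTE lj.
by rewrite lowerE lj.
Qed.

(** This is delta (delta - 1) - w (w - 1) for w = delta - n, where w (w - 1) is the eigenvalue of
    the Casimir element of sl(2) on w-densities. *)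
Definition casimir (n : nat) : R := n%:R * (2 * delta - n%:R - 1).

Lemma casimirB n p :
  casimir n - casimir p = (n%:R - p%:R) * (2 * delta - n%:R - p%:R - 1).
Proof. rewrite /casimir; ring. Qed.

Lemma casimir_inj s t :
    (forall l : nat, (2 <= l <= 2 * k)%N -> delta <> l%:R / 2) ->
  casimir (mdeg s) = casimir (mdeg t) <-> mdeg s = mdeg t.
Proof.
move=> nres; split=> [/eqP|->//]; rewrite -subr_eq0 casimirB mulf_eq0 => /orP[].
  by rewrite subr_eq0 eqr_nat => /eqP.
move=> /eqP dE; apply/eqP/negPn/negP => st.
(* The remaining factor vanishes when 2 delta = |s| + |t| + 1; this integer lies between 2 and 2 k,
   the degrees being distinct and at most k. *)
have := nres (mdeg s + mdeg t).+1; case.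
  by have := mdeg_le s; have := mdeg_le t; lia.
by rewrite -natr1 natrD; lra.
Qed.

(** The action of x^2 d/dx on monomials in the jets at 0 of densities of weights [lambda j]. The
    guard discards the [j] for which [lower] would leave [s] unchanged. *)
Definition lowering s t : R := \sum_(j | (0 < s j)%N && (lower j s == t))
  (s j)%:R * (2 * lambda j + (s j)%:R - 1).

Lemma lowering_deg s t : lowering s t != 0 -> mdeg s = (mdeg t).+1.
Proof.
apply: contra_neq_eq => st; rewrite /lowering big1 // => j /andP[sj /eqP tE].
by move: st; rewrite -tE -mdeg_lower // eqxx.
Qed.

Lemma lowering_sum (V : lmodType R) s (f : mindex m k -> V) :
  \sum_t lowering s t *: f t =
  \sum_j ((s j)%:R * (2 * lambda j + (s j)%:R - 1)) *: f (lower j s).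
Proof.
under eq_bigr do rewrite /lowering scaler_suml.
rewrite (exchange_big_dep predT) //=; apply: eq_bigr => j _.
case: (ltnP 0 (s j)) => [sj|]; last first.
  rewrite leqn0 => /eqP ->; rewrite mul0r scale0r big1 // => t.
by rewrite (big_pred1 (lower j s)) // => t; rewrite /= eq_sym.
Qed.

End MultiIndexKernel.

(** * The flow of x^2 d/dx on jets of densities *)

Section JetFlow.
Context {F : numFieldType}.
Implicit Types (t : F) (u : nat -> F) (n l : nat).

(** The recursion in [n] is the chain rule for |y|^(-2t) y^(-2n) J_n(-y), where J_n also depends on
    y through the jets at -1/y. *)
Fixpoint flow_coef t n l : {poly F} :=
  if n is n'.+1 then
    (2 * t + 2 * n'%:R) *: ('X * flow_coef t n' l) - 'X^2 * (flow_coef t n' l)^`()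
    + (if l is l'.+1 then flow_coef t n' l' else 0)
  else (l == 0)%:R.

(* The n-th coordinate of exp(z N) u, where N u_n = n (2 t + n - 1) u_(n-1) is
   the action of the vector field x^2 d/dx on the jets at 0 of t-densities. *)
Definition jet_flow t n u : {poly F} := \sum_(l < n.+1) u l *: flow_coef t n l.

Lemma flow_coef_gt t n l : (n < l)%N -> flow_coef t n l = 0.
Proof.
elim: n l => [|n IHn] [|l] //= nl.
by rewrite !IHn ?(ltnW nl) // mulr0 deriv0 mulr0 scaler0 subrr addr0.
Qed.

Lemma jet_flow0 t u : jet_flow t 0 u = (u 0)%:P.
Proof. by rewrite /jet_flow big_ord1 /= alg_polyC. Qed.

Lemma jet_flowS t n u : jet_flow t n.+1 u =
  (2 * t + 2 * n%:R) *: ('X * jet_flow t n u) - 'X^2 * (jet_flow t n u)^`()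
  + jet_flow t n (u \o succn).
Proof.
have -> : jet_flow t n u = \sum_(l < n.+2) u l *: flow_coef t n l.
  by rewrite big_ord_recr /= flow_coef_gt // scaler0 addr0.
rewrite /jet_flow /=; under eq_bigr do rewrite scalerDr scalerBr.
rewrite big_split sumrB /=; congr (_ - _ + _).
- rewrite mulr_sumr scaler_sumr; apply: eq_bigr => l _.
  by rewrite -scalerAr !scalerA mulrC.
- rewrite linear_sum mulr_sumr; apply: eq_bigr => l _.
  by rewrite linearZ /= -scalerAr.
- by rewrite big_ord_recl /= scaler0 add0r.
Qed.

Lemma jet_flow_at0 t n u : (jet_flow t n u).[0] = u n.
Proof.
elim: n u => [|n IHn] u; first by rewrite jet_flow0 hornerC.
by rewrite jet_flowS !(hornerE, IHn) /= mulr0 expr0n !mul0r subr0 add0r.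
Qed.

(** Together with [jet_flow_at0], this identifies [jet_flow] with exp(zN) u. *)
Lemma deriv_jet_flow t n u : (jet_flow t n u)^`() =
  (n%:R * (2 * t + n%:R - 1)) *: jet_flow t n.-1 u.
Proof.
elim: n u => [|n IHn] u; first by rewrite jet_flow0 derivC mul0r scale0r.
rewrite [in LHS]jet_flowS [n.+1.-1]/=.
rewrite !(derivD, derivN, derivZ, derivM, derivX, derivXn) !IHn /=.
have -> : (n.+1%:R = n%:R + 1 :> F) by rewrite natr1.
case: n IHn => [|n] IHn.
  rewrite /= !mul0r !scale0r deriv0 -!mul_polyC !(polyCD, polyCN, polyCM, polyC0, polyC1). ring.
(* The recursion read backwards eliminates the shifted sequence; what remains is an identity in
   [jet_flow t n.+1 u], [jet_flow t n u] and the derivative of the latter. *)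
rewrite derivZ /= (_ : jet_flow t n (u \o succn) = jet_flow t n.+1 u -
  ((2 * t + 2 * n%:R) *: ('X * jet_flow t n u) - 'X^2 * (jet_flow t n u)^`())); last first.
  by rewrite jet_flowS addrC addKr.
rewrite -natr1 -!mul_polyC !(polyCD, polyCN, polyCM, polyC0, polyC1); ring.
Qed.
End JetFlow.

(** By Leibniz's rule, [lowering] generates the flow on products of jets. *)
Lemma deriv_prod_jet_flow (R : realType) m k (lambda : 'I_m -> R)
    (u : 'I_m -> nat -> R) (s : mindex m k) :
  (\prod_j jet_flow (lambda j) (s j) (u j))^`() =
  \sum_t lowering lambda s t *: \prod_j jet_flow (lambda j) (t j) (u j).
Proof.
rewrite lowering_sum.
have derivP (r : seq 'I_m) (f : 'I_m -> {poly R}) : uniq r ->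
    (\prod_(j <- r) f j)^`() =
    \sum_(j <- r) \prod_(l <- r) (if l == j then (f l)^`() else f l).
  elim: r => [_|i r IHr /= /andP[ir ur]]; first by rewrite !big_nil -polyC1 derivC.
  rewrite big_cons derivM IHr // [RHS]big_cons big_cons eqxx; congr (_ * _ + _).
    by apply: eq_big_seq => l lr; case: eqP => // li; rewrite -li lr in ir.
  rewrite mulr_sumr; apply: eq_big_seq => j jr; rewrite big_cons.
  by case: eqP => // ij; rewrite ij jr in ir.
rewrite derivP ?index_enum_uniq //; apply: eq_bigr => j _.
rewrite (bigD1 j) //= eqxx deriv_jet_flow -scalerAl [in RHS](bigD1 j) //=.
rewrite lowerE eqxx; congr (_ *: (_ * _)).
by apply: eq_bigr => l /negbTE lj; rewrite lowerE lj.
Qed.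

(** * Invariance of transvectants under the flow *)

Section Transvectant.
Context {R : realType} {m k : nat}.
Variables (lambda : 'I_m -> R) (delta : R) (p : nat) (b : mindex m k -> R).
Hypothesis b_rec : forall s,
  (casimir delta (mdeg s) - casimir delta p) * b s = \sum_t lowering lambda t s * b t.
Hypothesis b_gt : forall s, (p < mdeg s)%N -> b s = 0.

(* By [b_rec] the derivative of the left-hand side in z vanishes. *)
Lemma transvectant_flow (u0 : nat -> R) (u : 'I_m -> nat -> R) (z : R) :
  \sum_s b s * ((jet_flow (delta - p%:R) (p - mdeg s) u0).[z] *
    \prod_j (jet_flow (lambda j) (s j) (u j)).[z]) =
  \sum_s b s * (u0 (p - mdeg s)%N * \prod_j u j (s j)).
Proof.
pose w0 n := jet_flow (delta - p%:R) n u0.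
pose w (s : mindex m k) := \prod_j jet_flow (lambda j) (s j) (u j).
pose P : {poly R} := \sum_s b s *: (w0 (p - mdeg s)%N * w s).
have PE x : \sum_s b s * ((jet_flow (delta - p%:R) (p - mdeg s) u0).[x] *
    \prod_j (jet_flow (lambda j) (s j) (u j)).[x]) = P.[x].
  by rewrite /P horner_sum; apply: eq_bigr => s _; rewrite hornerZ hornerM horner_prod.
(* By [jet_flow_at0] the right-hand side is the value at 0 of the same polynomial, so it suffices
   that [P] is constant. *)
rewrite PE; under [RHS]eq_bigr do rewrite -(jet_flow_at0 (delta - p%:R)).
under [RHS]eq_bigr do under eq_bigr => j _ do rewrite -(jet_flow_at0 (lambda j)).
rewrite PE; suff /size1_polyC -> : (size P <= 1)%N by rewrite !hornerC.
have : P^`() = 0.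
  rewrite /P linear_sum /=; under eq_bigr do rewrite linearZ /= derivM scalerDr.
  rewrite big_split /=.
  have -> : \sum_s b s *: (w0 (p - mdeg s)%N * (w s)^`()) =
      \sum_t (\sum_s lowering lambda s t * b s) *: (w0 (p - mdeg t).-1 * w t).
    under eq_bigr do rewrite deriv_prod_jet_flow mulr_sumr scaler_sumr.
    rewrite exchange_big; apply: eq_bigr => t _; rewrite scaler_suml.
    apply: eq_bigr => s _; rewrite -scalerAr scalerA.
    have [->|/lowering_deg ->] := eqVneq (lowering lambda s t) 0.
      by rewrite mulr0 mul0r !scale0r.
    by rewrite subnS mulrC.
  rewrite -big_split big1 // => s _ /=.
  rewrite deriv_jet_flow -scalerAl scalerA -scalerDl -b_rec.
  have [sp|ps] := leqP (mdeg s) p; last by rewrite b_gt // !(mul0r, mulr0) addr0 scale0r.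
  (* The weight delta - p makes (p - |s|)(2 (delta - p) + p - |s| - 1) the opposite of the
     difference of [casimir] values. *)
  rewrite (_ : _ + _ = 0) ?scale0r // casimirB natrB //; ring.
move=> P0; rewrite leqNgt; apply/negP => P1.
have := coef_deriv P (size P).-2; rewrite P0 coef0 => /esym/eqP.
rewrite mulrn_eq0 /= (_ : (size P).-2.+1 = (size P).-1); last first.
  by case: (size P) P1 => [|[]].
by rewrite -lead_coefE lead_coef_eq0 -size_poly_eq0 eqn0Ngt (ltnW P1).
Qed.
End Transvectant.

(** * Calculus on the line: derivatives under the inversion and explicit smooth functions *)

Section Calculus.
Context {R : realType}.
Implicit Types f g : R -> R.

Lemma derive1n_addn f n l : derive1n (n + l) f = derive1n n (derive1n l f).
Proof. by elim: n => //= n ->. Qed.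

Lemma near_neq0 (y : R) : y != 0 -> \forall z \near y, z != 0.
Proof. exact: (@open_neq R 0 y). Qed.

Lemma derive1n_neq0 f g n : (forall y, y != 0 -> f y = g y) ->
  forall y, y != 0 -> derive1n n f y = derive1n n g y.
Proof.
move=> fg; elim: n => //= n IHn y y0; rewrite !derive1E; apply: near_eq_derive.
by near=> z; apply: IHn; near: z; exact: near_neq0.
Unshelve. all: by end_near. Qed.

Lemma derive1n_lincomb (I : Type) (r : seq I) (c : I -> R) (f : I -> R -> R) n :
    (forall i, smooth (f i)) ->
  derive1n n (fun x => \sum_(i <- r) c i * f i x) =
  fun x => \sum_(i <- r) c i * derive1n n (f i) x.
Proof.
move=> sf; elim: n => //= n ->; apply/funext => x.
have sc i : smooth (cst (c i) \* derive1n n (f i)).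
  by apply: smoothM; [exact: smooth_cst|exact: smooth_derivn].
elim: r => [|i r IHr].
  by under eq_fun do rewrite big_nil; rewrite derive1_cst big_nil.
under eq_fun do rewrite big_cons; rewrite big_cons -IHr.
have -> : (fun x => c i * derive1n n (f i) x + \sum_(j <- r) c j * derive1n n (f j) x) =
    (cst (c i) \* derive1n n (f i)) \+ (fun x => \sum_(j <- r) c j * derive1n n (f j) x) by [].
rewrite derive1_addfun => [| z|z]; last 2 first.
- exact: smooth_derivable.
- by apply: smooth_derivable; apply: smooth_sumP.
rewrite /= derive1_mulfun /=; [|exact: smooth_cst|exact: smooth_derivn].
by rewrite derive1_cst mul0r add0r.
Qed.

Lemma derive1n_linear f g (c : R) n : smooth f -> smooth g ->
  derive1n n (fun x => c * f x + g x) = fun x => c * derive1n n f x + derive1n n g x.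
Proof.
move=> sf sg; pose h (b : bool) := if b then f else g.
have sh b : smooth (h b) by case: b.
have := derive1n_lincomb [:: true; false] (fun b : bool => if b then c else 1) n sh.
have E (u v : R -> R) : (fun x => \sum_(b <- [:: true; false])
    (if b then c else 1) * (if b then u else v) x) = fun x => c * u x + v x.
  by apply/funext => x; rewrite !big_cons big_nil addr0 mul1r.
rewrite {1}/h E => ->; rewrite -E; apply/funext => x.
by apply: eq_bigr => -[].
Qed.

Lemma smooth_lincomb (I : Type) (r : seq I) (P : pred I) (c : I -> R) (f : I -> R -> R) :
  (forall i, smooth (f i)) -> smooth (fun x => \sum_(i <- r | P i) c i * f i x).
Proof.
move=> sf; apply: smooth_sumP => i.
by apply: (@smoothM _ (cst (c i))) => //; exact: smooth_cst.
Qed.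

Lemma is_derive_smooth f (x : R) : smooth f -> is_derive x 1 f (derive1 f x).
Proof. by move=> sf; rewrite derive1E; apply: derivableP; exact: smooth_derivable. Qed.

Lemma is_derive_inversion (y : R) : y != 0 -> is_derive y 1 (fun z : R => - z^-1) (y ^- 2).
Proof.
move=> y0; have := is_deriveN (is_deriveV y0 (is_derive_id y 1)).
by rewrite scaleNr opprK /GRing.scale/= mulr1.
Qed.

Lemma is_derive_powR_norm (e y : R) : y != 0 ->
  is_derive y 1 (fun z => `|z| `^ e) (e / y * `|y| `^ e).
Proof.
move=> y0.
(* With [s] the sign of [y], |z| = s z near [y], which reduces to the power function on positive
   reals. *)
have [s [s2 sy]] : exists s : R, s ^+ 2 = 1 /\ 0 < s * y.
  exists (Num.sg y); rewrite sqr_sg y0; split=> //.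
  by rewrite -normrEsg normr_gt0.
have s0 : s != 0 by apply: contraTneq sy => ->; rewrite mul0r ltxx.
have nE (z : R) : 0 < s * z -> `|z| = s * z.
  move=> sz; have /eqP : `|s| ^+ 2 = 1 by rewrite -normrX s2 normr1.
  rewrite sqrf_eq1 => /orP[/eqP s1|/eqP s1]; last first.
    by have := normr_ge0 s; rewrite s1 oppr_ge0 ler10.
  by rewrite -[RHS]gtr0_norm // normrM s1 mul1r.
have near_ab : \forall z \near y, (fun z => (s * z) `^ e) z = `|z| `^ e.
  have : \forall z \near y, 0 < s * z.
    have : ((fun z => s * z) @ y --> s * y)%classic.
      by apply: cvgM; [exact: cvg_cst|exact: cvg_id].
    by move=> /cvgr_gt; apply.
  by apply: filterS => z sz; rewrite nE.
have ds : is_derive y 1 (fun z => s * z) s.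
  have := @is_deriveZ R _ _ id s y 1 1 (is_derive_id _ _).
  by rewrite /GRing.scale/= mulr1.
have d1 : is_derive y 1 (fun z => (s * z) `^ e) ((e * (s * y) `^ (e - 1)) * s).
  exact: (@is_derive1_comp R (fun z : R => z `^ e) (fun z => s * z) y _ _
           (is_derive1_powR e sy) ds).
have := near_eq_is_derive near_ab d1; congr (is_derive _ _ _ _).
rewrite /= nE // powRB; last by rewrite (gt_eqF sy) implybT.
rewrite powRr1 ?ltW //; field; by rewrite y0 s0.
Qed.

(* Near y, the inversion is the flow of x^2 d/dx at time -y, up to translations
   and a dilation. *)
Lemma derive1n_inversion (t : R) f g n (y : R) : y != 0 -> smooth f ->
    (forall y, y != 0 -> g y = `|y| `^ (- (2 * t)) * f (- y^-1)) ->
  derive1n n g y = `|y| `^ (- (2 * t)) * y ^- (2 * n) *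
    (jet_flow t n (fun l => derive1n l f (- y^-1))).[- y].
Proof.
move=> + sf gE; elim: n y => [|n IHn] y y0.
  by rewrite muln0 expr0 invr1 mulr1 jet_flow0 hornerC /= gE.
pose h l z : R := derive1n l f (- z^-1).
rewrite [LHS]/=; set G := (X in _ -> X = _) in IHn.
have jetE z : (jet_flow t n (h ^~ z)).[- z] =
    (\sum_(l < n.+1) fun z => h l z * (flow_coef t n l).[- z]) z.
  rewrite horner_sum fct_sumE; apply: eq_bigr => l _; by rewrite hornerZ.
have dh l : is_derive y 1 (h l) (h l.+1 y * y ^- 2).
  apply: is_derive1_comp (is_derive_inversion y0).
  by apply: is_derive_smooth; exact: smooth_derivn.
have dN : is_derive y 1 (fun z : R => - z) (- 1).
  exact: is_deriveN (is_derive_id y 1).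
have dc l : is_derive y 1 (fun z => (flow_coef t n l).[- z])
    (- (flow_coef t n l)^`().[- y]).
  have := @is_derive1_comp R (horner (flow_coef t n l)) (fun z => - z) y _ _
    (is_derive_poly _ _) dN.
  by rewrite mulrN1.
(* Both the base point of the jet and the argument [- z] move: they yield the shifted jet divided by
   y^2 and the derivative of the polynomial, which are the last two terms of [jet_flowS] after
   division by y^2. *)
have dJ : is_derive y 1 (fun z => (jet_flow t n (h ^~ z)).[- z])
   (- (jet_flow t n (h ^~ y))^`().[- y]
     + y ^- 2 * (jet_flow t n (h ^~ y \o succn)).[- y]).
  under eq_fun do rewrite jetE.
  have := @is_derive_sum R _ _ _ _ y 1 _ (fun l : 'I_n.+1 => is_deriveM (dh l) (dc l)).
  congr (is_derive _ _ _ _).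
  rewrite /jet_flow linear_sum /= !horner_sum big_split mulr_sumr -sumrN /=.
  congr (_ + _); apply: eq_bigr => l _; rewrite ?linearZ /= !hornerZ /GRing.scale/=.
    by rewrite mulrN.
  rewrite /h; ring.
have dV : is_derive y 1 (fun z : R => z ^- (2 * n)) (- (2 * n)%:R / y * y ^- (2 * n)).
  have yn0 : y ^+ (2 * n) != 0 by rewrite expf_neq0.
  have dX : is_derive y 1 (fun z : R => z ^+ (2 * n)) ('X^(2 * n))^`().[y].
    have := is_derive_poly ('X^(2 * n)) y.
    by rewrite (_ : horner _ = fun z => z ^+ (2 * n)) //; apply/funext => z; rewrite hornerXn.
  have := @is_deriveV R (fun z => z ^+ (2 * n)) y _ 1 yn0 dX; congr (is_derive _ _ _ _).
  rewrite derivXn hornerMn hornerXn /GRing.scale/=.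
  case: (2 * n)%N yn0 => [|l] yn0; first by rewrite mulr0n oppr0 mulr0 !mul0r.
  rewrite /= -mulr_natr; move: (l.+1%:R : R) => N; rewrite (exprS y l).
  by field; rewrite y0 expf_neq0.
have dG := is_deriveM (is_deriveM (is_derive_powR_norm (- (2 * t)) y0) dV) dJ.
move=> IH; rewrite /G derive1E.
have near_G : \forall z \near y, (fun z => `|z| `^ (- (2 * t)) * z ^- (2 * n) *
    (jet_flow t n (h ^~ z)).[- z]) z = derive1n n g z.
  by apply: filterS (near_neq0 y0) => z z0; rewrite IH.
have [_ ->] := near_eq_is_derive near_G dG.
have -> : (fun l => derive1n l f (- y^-1)) = h ^~ y by [].
rewrite jet_flowS !(hornerD, hornerN, hornerZ, hornerM, hornerX, hornerXn) fctE.
rewrite /GRing.scale/= mulnS exprD natrM.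
by field; rewrite y0 expf_neq0.
Qed.

Lemma smooth_horner (p : {poly R}) : smooth (horner p).
Proof.
apply: (@smooth_coind _ (fun f => exists p : {poly R}, f = horner p)); last by exists p.
move=> _ [q ->]; split=> [x|]; first exact: derivable_horner.
by exists q^`(); rewrite derivE.
Qed.

(** These functions form a class stable under differentiation, the exponent dropping by one. They
    provide densities on the whole circle. *)
Lemma smooth_powR_1Dsqr (p : {poly R}) (e : R) :
  smooth (fun x => p.[x] * (1 + x ^+ 2) `^ e).
Proof.
pose F (p : {poly R}) (e x : R) := p.[x] * (1 + x ^+ 2) `^ e.
suff dF (q : {poly R}) (a x : R) : is_derive x 1 (F q a)
    (F (q^`() * (1 + 'X^2) + (2 * a) *: ('X * q)) (a - 1) x).
  apply: (@smooth_coind _ (fun f => exists p e, f = F p e)); last by exists p, e.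
  move=> _ [q [a ->]]; split=> [x|]; first by have [] := dF q a x.
  eexists _, _; apply/funext => x; rewrite derive1E; have [_ ->] := dF q a x.
  reflexivity.
have x1 : 0 < 1 + x ^+ 2 by rewrite ltr_wpDr ?sqr_ge0.
have dX : is_derive x 1 (fun z : R => 1 + z ^+ 2) (2 * x).
  have := is_derive_poly (1 + 'X^2) x.
  have -> : horner (1 + 'X^2) = (fun z : R => 1 + z ^+ 2).
    by apply/funext => z; rewrite !hornerE.
  by rewrite derivD derivXn -polyC1 derivC !hornerE mulr2n mulrDl mul1r.
have dP := @is_derive1_comp R (fun z : R => z `^ a) (fun z => 1 + z ^+ 2) x _ _
  (is_derive1_powR a x1) dX.
have := is_deriveM (is_derive_poly q x) dP; congr (is_derive _ _ _ _).
rewrite /F /GRing.scale /= !(hornerD, hornerM, hornerZ, hornerX, hornerXn, hornerC).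
rewrite powRB ?powRr1 ?ltW // ?(gt_eqF x1) ?implybT //.
by field; rewrite gt_eqF.
Qed.

(** Differentiating once leaves a factor of order one less times another smooth function, whence the
    induction. *)
Lemma derive1n_root_factor f (x0 : R) n l : smooth f -> (l <= n)%N ->
  derive1n l (fun x => (x - x0) ^+ n * f x) x0 = if l == n then n`!%:R * f x0 else 0.
Proof.
elim: n l f => [|n IHn] l f sf.
  by rewrite leqn0 => /eqP -> /=; rewrite expr0 fact0.
case: l => [_|l ln]; first by rewrite /= subrr expr0n mul0r.
have E p : (fun x : R => (x - x0) ^+ p) = horner (('X - x0%:P) ^+ p).
  by apply/funext => x; rewrite horner_exp !hornerE.
rewrite derive1Sn (_ : derive1 _ =
    (fun x => (x - x0) ^+ n * (n.+1%:R * f x + (x - x0) * derive1 f x))); last first.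
  have sE : smooth (fun x : R => (x - x0) ^+ n.+1) by rewrite E; exact: smooth_horner.
  apply/funext => x; rewrite (derive1_mulfun sE sf) /= E -derivE deriv_exp derivXsubC mul1r.
  rewrite hornerMn !horner_exp hornerXsubC -mulr_natr exprS; ring.
rewrite IHn //; last first.
  apply: (@smoothD _ (fun x => n.+1%:R * f x) (fun x => (x - x0) * derive1 f x)).
    by apply: (@smoothM _ (cst _)) => //; exact: smooth_cst.
  apply: (@smoothM _ (fun x => x - x0)); last exact: smooth_deriv.
  by have := smooth_horner ('X - x0%:P); congr smooth; apply/funext => x; rewrite !hornerE.
by rewrite eqSS; case: eqP => // _; rewrite subrr mul0r addr0 factS natrM; ring.
Qed.
End Calculus.

(** * Global test densities and uniqueness of coefficients *)

Section Densities.
Context {R : realType}.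

Lemma glued_sym (t : R) (f g : R -> R) :
    (forall y : R, y != 0 -> g y = `|y| `^ (- (2 * t)) * f (- y^-1)) ->
  forall y : R, y != 0 -> f y = `|y| `^ (- (2 * t)) * g (- y^-1).
Proof.
move=> gE y y0; rewrite gE ?oppr_eq0 ?invr_eq0 // invrN invrK opprK mulrA.
rewrite normrN normfV -powRM ?normr_ge0 ?invr_ge0 // divff ?normr_eq0 //.
by rewrite powR1 mul1r.
Qed.

(** Global densities vanishing to exact order [n] at a point, on which operators are tested to
    isolate a coefficient. *)
Lemma density_jet (M : manifold) (t : R) (c : chart M) (x0 : R) (n : nat) :
  exists phi : density M t,
    (forall l, (l < n)%N -> derive1n l (phi c) x0 = 0) /\ derive1n n (phi c) x0 != 0.
Proof.
suff [phi [f [sf f0 phiE]]] : exists phi : density M t, exists f : R -> R,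
    [/\ smooth f, f x0 != 0 & phi c = fun x => (x - x0) ^+ n * f x].
  exists phi; rewrite phiE; split=> [l ln|]; rewrite derive1n_root_factor //.
  - by rewrite ltn_eqF.
  - exact: ltnW.
  - by rewrite eqxx mulf_neq0 // pnatr_eq0 -lt0n fact_gt0.
case: M c => [c|c].
  have P : (fun _ : chart Line => horner (('X - x0%:P) ^+ n)) \in is_density Line t.
    by apply/asboolP; split=> // d; exact: smooth_horner.
  exists (Density P), (cst 1); split; [exact: smooth_cst|exact: oner_neq0|].
  by apply/funext => x; rewrite /= horner_exp !hornerE.
(* (x - x0)^n (1 + x^2)^(-t - n) (dx)^t extends smoothly to x = oo. *)
pose e := - t - n%:R.
pose f (x : R) := (x - x0) ^+ n * (1 + x ^+ 2) `^ e.
(* This is [f] seen in the other chart: since -2t - 2e - 2n = 0, the powers of |y| cancel and the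
   expression is smooth at 0. *)
pose g (y : R) := (- y - x0 * y ^+ 2) ^+ n * (1 + y ^+ 2) `^ e.
have fE : f = fun x => (('X - x0%:P) ^+ n).[x] * (1 + x ^+ 2) `^ e.
  by apply/funext => x; rewrite /f horner_exp !hornerE.
have gE : g = fun x => ((- 'X - x0 *: 'X^2) ^+ n).[x] * (1 + x ^+ 2) `^ e.
  by apply/funext => x; rewrite /g horner_exp !hornerE.
have gl y : y != 0 -> g y = `|y| `^ (- (2 * t)) * f (- y^-1).
  move=> y0; have y20 : 0 < y ^+ 2 by rewrite exprn_even_gt0.
  have n0 : 0 < `|y| by rewrite normr_gt0.
  have -> : f (- y^-1) = (- y^-1 - x0) ^+ n * ((1 + y ^+ 2) `^ e * (`|y| `^ (2 * t) * y ^+ (2 * n))).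
    rewrite /f; congr (_ * _).
    have -> : 1 + (- y^-1) ^+ 2 = (1 + y ^+ 2) * y ^- 2 by field.
    rewrite powRM ?invr_ge0 ?ltW // ?ltr_wpDr ?sqr_ge0 //; congr (_ * _).
    have -> : y ^- 2 = `|y| `^ (- 2%:R) by rewrite powRN powR_mulrn // real_normK ?num_real.
    have -> : y ^+ (2 * n) = `|y| `^ (2 * n)%:R.
      by rewrite powR_mulrn // !exprM real_normK ?num_real.
    rewrite -powRrM -powRD ?(gt_eqF n0) ?implybT // natrM; congr (_ `^ _); rewrite /e; ring.
  rewrite /g [RHS](_ : _ = (`|y| `^ (- (2 * t)) * `|y| `^ (2 * t)) *
     (((- y^-1 - x0) ^+ n * y ^+ (2 * n)) * (1 + y ^+ 2) `^ e)); last by ring.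
  rewrite -powRD ?(gt_eqF n0) ?implybT // addNr powRr0 mul1r exprM -exprMn; congr (_ ^+ _ * _).
  by field.
(* The function [f] goes in the chart [c] of the given point, whichever it is; the gluing relation
   is symmetric. *)
pose a (d : chart Circle) := if d == c then f else g.
have aP : a \in is_density Circle t.
  apply/asboolP; split=> [d|].
    by rewrite /a; case: ifP => _; rewrite ?fE ?gE; exact: smooth_powR_1Dsqr.
  by rewrite /= /a; case: (c) => //=; exact: glued_sym.
exists (Density aP), (fun x => (1 + x ^+ 2) `^ e); split.
- have := smooth_powR_1Dsqr 1 e; congr smooth; apply/funext => x.
  by rewrite -polyC1 hornerC mul1r.
- by rewrite gt_eqF // powR_gt0 // ltr_wpDr ?sqr_ge0.
- by rewrite /= /a eqxx.
Qed.

(** Descending induction on the degree. Testing on [phi j] vanishing to exact order [s j] at [x]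
    leaves only [s] and the [t] that dominate it entrywise; for [t] different from [s] the degree is
    larger, so [a t] is already 0. *)
Lemma coef_uniq (M : manifold) m k (lambda : 'I_m -> R) (c : chart M) (x : R)
    (a : mindex m k -> R) :
    (forall phi : forall j, density M (lambda j),
      \sum_s a s * \prod_j derive1n (s j) (phi j c) x = 0) ->
  forall s, a s = 0.
Proof.
move=> a0 s; have [n] := ubnP (k - mdeg s)%N; elim: n s => // n IHn s sn.
pose phi j := sval (cid (density_jet (lambda j) c x (s j))).
have phiP j := svalP (cid (density_jet (lambda j) c x (s j))).
have := a0 phi; rewrite (bigD1 s) //= [X in _ + X]big1 ?addr0 => [/eqP|t ts].
  rewrite mulf_eq0 => /orP[/eqP //|/prodf_eq0[j _]].
  by rewrite (negbTE (phiP j).2).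
have [/existsP[j tj]|/existsPn st] := boolP [exists j, (t j < s j)%N].
  by rewrite (bigD1 j) //= (phiP j).1 // mul0r mulr0.
have sEt : (mdeg s <= mdeg t ?= iff [forall j, s j == t j])%N.
  by apply: leqif_sum => j _; split=> //; rewrite leqNgt st.
rewrite ltnS in sn; rewrite IHn ?mul0r //; apply: leq_trans sn.
have ltst : (mdeg s < mdeg t)%N.
  rewrite ltn_neqAle sEt.1 andbT sEt.2; apply: contra ts => /forallP sjt.
  by rewrite eq_sym; apply/eqP/val_inj/ffunP => j; apply/eqP/sjt.
by rewrite ltn_sub2l // (leq_trans ltst) // mdeg_le.
Qed.
End Densities.

(** * Comparison of the two charts of the circle *)

Section Gluing.
Context {R : realType} {m k : nat}.

Lemma smooth_eq0 (f g : R -> R) : smooth f -> smooth g ->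
  (forall y, y != 0 -> f y = g y) -> f 0 = g 0.
Proof.
move=> sf sg fg.
have cont (h : R -> R) : smooth h -> (h @ 0^' --> h 0)%classic.
  move=> sh; apply: cvg_within_filter; apply: differentiable_continuous.
  by apply/derivable1_diffP; exact: smooth_derivable.
rewrite -(cvg_lim (@Rhausdorff R) (cont f sf)); apply: cvg_lim => //.
apply: cvg_trans (cont g sg); apply: near_eq_cvg.
by near=> y; rewrite fg //; near: y; exact: nbhs_dnbhs_neq.
Unshelve. all: by end_near. Qed.

(** The gluing relation determines the other chart away from 0, and continuity does so at 0.
    Identities of densities can thus be checked in the affine coordinate. *)
Lemma density_ext (M : manifold) (t : R) (a b : density M t) :
  (forall x, a (affine M) x = b (affine M) x) -> a = b.
Proof.
case: a b => f fP [g gP] /= fg; apply: val_inj => /=; apply/funext => c; apply/funext => x.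
move: fP gP => /asboolP[sf gf] /asboolP[sg gg].
case: M f g c sf sg gf gg fg => [f g [] _ _ _ _|f g c sf sg /= gf gg fg]; first exact.
case: c => //.
have fgx y : y != 0 -> f false y = g false y by move=> y0; rewrite gf // gg // fg.
have [->|/fgx //] := eqVneq x 0; exact: smooth_eq0.
Qed.

(** Common form of the symbol map and of its inverse. The output index comes first, so the constants
    alpha^s_i enter transposed; the truncated subtraction is harmless when [c s i] vanishes for |i|
    < |s|. *)
Definition graded_op (c : mindex m k -> mindex m k -> R) (f : mindex m k -> R -> R)
    (s : mindex m k) (x : R) : R :=
  \sum_i c s i * derive1n (mdeg i - mdeg s) (f i) x.

Lemma smooth_graded_op c f s : (forall i, smooth (f i)) -> smooth (graded_op c f s).
Proof. by move=> sf; apply: smooth_lincomb => i; exact: smooth_derivn. Qed.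

(** For triangular matrices the orders of differentiation add up, so composition is the matrix
    product. *)
Lemma graded_op_comp c e f s x :
    (forall s i, (mdeg i < mdeg s)%N -> c s i = 0) ->
    (forall s i, (mdeg i < mdeg s)%N -> e s i = 0) ->
    (forall i, smooth (f i)) ->
  graded_op c (graded_op e f) s x =
  graded_op (fun s t => \sum_i c s i * e i t) f s x.
Proof.
move=> c0 e0 sf; rewrite /graded_op.
under [RHS]eq_bigr do rewrite mulr_suml.
rewrite [RHS]exchange_big; apply: eq_bigr => i _ /=.
rewrite derive1n_lincomb; last by move=> t; exact: smooth_derivn.
rewrite mulr_sumr; apply: eq_bigr => t _; rewrite mulrA.
have [si|si] := ltnP (mdeg i) (mdeg s); first by rewrite c0 // !mul0r.
have [it|it] := ltnP (mdeg t) (mdeg i); first by rewrite e0 // mulr0 !mul0r.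
by rewrite -derive1n_addn addnC addnBA // subnK.
Qed.

Lemma prod_powR (r e : R) (I : finType) (f : I -> R) : 0 < r ->
  \prod_i r `^ f i = r `^ (\sum_i f i).
Proof.
move=> r0; apply: esym; apply: (big_morph (fun e => r `^ e)) => [x y|].
  by rewrite powRD // (gt_eqF r0) implybT.
exact: powRr0.
Qed.

(** By [derive1n_inversion] every jet is moved by the flow at time -y, up to powers of y whose total
    exponent -2 (p - |s|) - 2 |s| = -2p does not depend on s; [transvectant_flow] then removes the
    flow. *)
Lemma transvectant_inversion (lambda : 'I_m -> R) (delta : R) (p : nat)
    (b : mindex m k -> R) (u v : R -> R) (phi : forall j, density Circle (lambda j)) (y : R) :
    (forall s, (casimir delta (mdeg s) - casimir delta p) * b s =
      \sum_t lowering lambda t s * b t) ->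
    (forall s, (p < mdeg s)%N -> b s = 0) ->
    smooth u -> y != 0 ->
    (forall y, y != 0 -> v y = `|y| `^ (- (2 * (delta - p%:R))) * u (- y^-1)) ->
  \sum_s b s * (derive1n (p - mdeg s) v y * \prod_j derive1n (s j) (phi j false) y) =
  `|y| `^ (- (2 * (delta + \sum_j lambda j))) *
    \sum_s b s * (derive1n (p - mdeg s) u (- y^-1) *
      \prod_j derive1n (s j) (phi j true) (- y^-1)).
Proof.
move=> b_rec b_gt su y0 vE.
rewrite -(transvectant_flow b_rec b_gt (fun l => derive1n l u (- y^-1))
  (fun j l => derive1n l (phi j true) (- y^-1)) (- y)) mulr_sumr.
apply: eq_bigr => s _; have [sp|sp] := leqP (mdeg s) p; last first.
  by rewrite b_gt // !mul0r mulr0.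
have phiE j n : derive1n n (phi j false) y = `|y| `^ (- (2 * lambda j)) * y ^- (2 * n) *
    (jet_flow (lambda j) n (fun l => derive1n l (phi j true) (- y^-1))).[- y].
  by apply: derive1n_inversion => //; [exact: density_smooth|have /asboolP[] := valP (phi j)].
rewrite (derive1n_inversion _ y0 su vE); under eq_bigr do rewrite phiE.
rewrite !big_split /= prod_powR ?normr_gt0 // prodfV prodrXr.
rewrite -big_distrr /= -/(mdeg s).
have n0 : 0 < `|y| by rewrite normr_gt0.
have yE : y ^+ (2 * p) = `|y| `^ (2 * p%:R).
  by rewrite -natrM powR_mulrn // !exprM real_normK ?num_real.
have -> : - (2 * (delta + \sum_j lambda j)) =
    - (2 * (delta - p%:R)) + \sum_j - (2 * lambda j) - 2 * p%:R.
  by rewrite sumrN -mulr_sumr; ring.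
rewrite !powRD ?(gt_eqF n0) ?implybT // (powRN _ (2 * p%:R)) -yE.
have -> : y ^+ (2 * p) = y ^+ (2 * (p - mdeg s)) * y ^+ (2 * mdeg s).
  by rewrite -exprD -mulnDr subnK.
rewrite invfM; ring.
Qed.
End Gluing.

(** * Gluing of the symbol on the circle *)

Section Symbol.
Context {R : realType} {m k : nat}.
Variables (lambda : 'I_m -> R) (delta : R).
Hypothesis delta_nres :
  forall l : nat, (2 <= l <= 2 * k)%N -> delta <> l%:R / 2.
Local Notation q s := (casimir delta (mdeg s)).
Local Notation I := (mindex m k).

(** Extension by zero below the diagonal makes the induction formula a matrix identity over all
    pairs. *)
Definition equivariant_coef (a : I -> I -> R) : Prop :=
  (forall s i, (mdeg s < mdeg i)%N -> a s i = 0) /\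
  forall s i, (q s - q i) * a s i = \sum_t lowering lambda s t * a t i.

Lemma equivariant_coef_exists (B : I -> I -> R) :
  exists a, equivariant_coef a /\ forall s i, mdeg s = mdeg i -> a s i = B s i.
Proof.
have [a [aB a0 a_rec]] := triangular_solution
  (fun s i => casimir_inj s i delta_nres) (@lowering_deg R m k lambda) B.
by exists a.
Qed.

(** The transposed recursion runs downwards, so it is solved with the codegree k - |s| in place of
    the degree. *)
Lemma dual_coef_exists : exists b : I -> I -> R,
  [/\ forall s i, mdeg s = mdeg i -> b s i = (s == i)%:R,
      forall s i, (mdeg i < mdeg s)%N -> b s i = 0 &
      forall s i, (q s - q i) * b s i = \sum_t lowering lambda t s * b t i].
Proof.
pose d (s : I) := (k - mdeg s)%N.
have dE s i : d s = d i <-> mdeg s = mdeg i.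
  by rewrite /d; have := mdeg_le s; have := mdeg_le i; split; lia.
have [|s t /lowering_deg tE|b [b1 b0 b_rec]] :=
    @triangular_solution R I d (fun s => q s) (fun s t => lowering lambda t s) _ _
      (fun s i => (s == i)%:R).
- by move=> s i; rewrite (casimir_inj s i delta_nres) dE.
- by rewrite /d; have := mdeg_le t; lia.
exists b; split=> // s i si; first by apply: b1; rewrite dE.
by apply: b0; rewrite /d; have := mdeg_le s; lia.
Qed.

Section Glue.
Variables (mu : R) (A : diffop Circle k lambda mu) (a : bool -> I -> R -> R).
Hypothesis deltaE : delta = mu - \sum_j lambda j.
Hypothesis aE : forall c, @expresses R Circle m k lambda mu c (a c) A.

Lemma graded_op_glued al (i : I) (y : R) : equivariant_coef al -> y != 0 ->
  graded_op (fun i s => al s i) (a false) i y =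
  `|y| `^ (- (2 * (delta - (mdeg i)%:R))) *
    graded_op (fun i s => al s i) (a true) i (- y^-1).
Proof.
move=> [al0 al_rec] y0.
have sa c s : smooth (a c s) by have [] := aE c.
have [a1 [[a10 a1_rec] a11]] := equivariant_coef_exists (fun s i => (s == i)%:R).
have [b [b1 b0 b_rec]] := dual_coef_exists.
have dual al' := triangular_dual (fun s i => casimir_inj s i delta_nres) (a := al')
  (K := lowering lambda) (b := b).
have ba1 : forall s t, \sum_i b s i * a1 t i = (s == t)%:R.
  apply: left_inverse_sum => j l; rewrite dual //.
  case: ifP => [/eqP jl|jl]; first by rewrite a11 // eq_sym.
  by case: eqP => // jE; rewrite jE eqxx in jl.
pose u c := graded_op (fun i s => a1 s i) (a c).
have su c j : smooth (u c j) by exact: smooth_graded_op.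
(* Since [b] inverts [a1], each coefficient is recovered from the [u c j]: the operator is a sum of
   transvectants of them. *)
have uK c s x : a c s x = graded_op b (u c) s x.
  rewrite graded_op_comp //; last by move=> j l; exact: a10.
  rewrite /graded_op (bigD1 s) //= ba1 eqxx mul1r subnn big1 ?addr0 // => t ts.
  by rewrite ba1 eq_sym (negbTE ts) mul0r.
pose ut j z := `|z| `^ (- (2 * (delta - (mdeg j)%:R))) * u true j (- z^-1).
(* Both [u false] and the transported [ut] represent [A] in the second chart, the latter by
   covariance of transvectants; uniqueness of coefficients compares them. *)
have glue_op s z : z != 0 ->
    \sum_j b s j * (derive1n (mdeg j - mdeg s) (u false j) z -
                    derive1n (mdeg j - mdeg s) (ut j) z) = 0.
  move=> z0; move: s; apply: (@coef_uniq R Circle m k lambda false z) => phi.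
  have AE c x : diffop_fun A phi c x = \sum_j \sum_s
      b s j * (derive1n (mdeg j - mdeg s) (u c j) x * \prod_l derive1n (s l) (phi l c) x).
    have [_ ->] := aE c; rewrite exchange_big; apply: eq_bigr => s _.
    by rewrite uK mulr_suml; apply: eq_bigr => j _; rewrite mulrA.
  have /asboolP[_ /(_ z z0)] := valP (diffop_fun A phi).
  rewrite -[val _]/(density_fun (diffop_fun A phi)) !AE => E.
  transitivity (\sum_j \sum_s (b s j * (derive1n (mdeg j - mdeg s) (u false j) z *
        \prod_l derive1n (s l) (phi l false) z) -
      b s j * (derive1n (mdeg j - mdeg s) (ut j) z *
        \prod_l derive1n (s l) (phi l false) z))).
    rewrite exchange_big; apply: eq_bigr => s _; rewrite mulr_suml.
    by apply: eq_bigr => j _; ring.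
  under eq_bigr do rewrite sumrB.
  rewrite sumrB E mulr_sumr -sumrB big1 // => j _; apply/eqP; rewrite subr_eq0; apply/eqP.
  have -> : mu = delta + \sum_j lambda j by rewrite deltaE subrK.
  by rewrite (@transvectant_inversion R m k lambda delta (mdeg j) (b ^~ j) (u true j)) //;
    move=> s; exact: b0.
(* Descending induction on |j|: [b] is the identity within a degree, and its other terms involve
   higher degrees, already settled. *)
have ut_glue j z : z != 0 -> u false j z = ut j z.
  have [n] := ubnP (k - mdeg j)%N; elim: n j z => // n IHn j z jn z0.
  have := glue_op j z z0; rewrite (bigD1 j) //= big1 => [|l lj].
    by rewrite addr0 b1 // eqxx mul1r subnn /= => /eqP; rewrite subr_eq0 => /eqP.
  have [lj'|jl|/esym lj'] := ltngtP (mdeg l) (mdeg j).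
  - by rewrite b0 ?mul0r.
  - rewrite (derive1n_neq0 (g := ut l)) ?subrr ?mulr0 // => x x0.
    by apply: IHn => //; have := mdeg_le l; lia.
  - by rewrite b1 // eq_sym (negbTE lj) mul0r.
(* By [triangular_dual] only the [j] with |j| = |i| remain, all of the same weight, so gluing passes
   to the combination. *)
have alE c x : graded_op (fun i s => al s i) (a c) i x =
    \sum_j (if mdeg i == mdeg j then al j i else 0) * u c j x.
  have -> : a c = graded_op b (u c) by apply/funext => s; apply/funext => z.
  rewrite graded_op_comp //; last by move=> j l; exact: al0.
  apply: eq_bigr => j _; rewrite dual //.
  by case: eqP => [->|]; rewrite ?subnn // !mul0r.
rewrite !alE mulr_sumr; apply: eq_bigr => j _; rewrite ut_glue // /ut.
by case: eqP => [->|_]; rewrite ?mul0r ?mulr0 // mulrCA.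
Qed.
End Glue.
End Symbol.

(** * The action of quadratic vector fields on coefficients and symbols *)

Section Equivariance.
Context {R : realType}.

Lemma derive1_quadratic (c0 c1 c2 : R) :
  derive1 (fun x => c0 + c1 * x + c2 * x ^+ 2) = (fun x => c1 + 2 * c2 * x).
Proof.
have -> : (fun x => c0 + c1 * x + c2 * x ^+ 2) = horner (c0%:P + c1 *: 'X + c2 *: 'X^2).
  by apply/funext => x; rewrite !hornerE.
rewrite -derivE; apply/funext => x.
by rewrite !(derivD, derivC, derivZ, derivX, derivXn) !hornerE mulr2n; ring.
Qed.

(** Leibniz's formula stops at X'' = 2 c2, whose total coefficient is n (n - 1) / 2 + n t. For
    [n = 0] the index [n.-1] is multiplied by 0. *)
Lemma derive1n_lie_quadratic (c0 c1 c2 t : R) (X f : R -> R) (n : nat) :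
    smooth X -> X = (fun x => c0 + c1 * x + c2 * x ^+ 2) -> smooth f ->
  derive1n n (fun x => X x * derive1 f x + t * derive1 X x * f x) =
  fun x => X x * derive1n n.+1 f x + (n%:R + t) * derive1 X x * derive1n n f x
    + c2 * (n%:R * (2 * t + n%:R - 1)) * derive1n n.-1 f x.
Proof.
move=> sX XE sf.
have ddX x : derive1 (derive1 X) x = 2 * c2.
  rewrite XE derive1_quadratic (_ : (fun x => _) = fun x => c1 + 2 * c2 * x + 0 * x ^+ 2).
    by rewrite derive1_quadratic mulr0 mul0r addr0.
  by apply/funext => z; rewrite mul0r addr0.
elim: n => [|n IHn]; first by apply/funext => x /=; rewrite !mul0r mulr0 mul0r addr0 add0r.
rewrite [LHS]/= IHn; set K := c2 * _.
have sg l : smooth (derive1n l f) by exact: smooth_derivn.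
have sY : smooth (cst (n%:R + t) \* derive1 X).
  by apply: smoothM; [exact: smooth_cst|exact: smooth_deriv].
have s1 := smoothM sX (sg n.+1); have s2 := smoothM sY (sg n).
have s3 := smoothM (smooth_cst K) (sg n.-1).
apply/funext => x.
have -> : (fun x => X x * derive1n n.+1 f x + (n%:R + t) * derive1 X x * derive1n n f x
    + K * derive1n n.-1 f x) = ((X \* derive1n n.+1 f) \+
    ((cst (n%:R + t) \* derive1 X) \* derive1n n f)) \+ (cst K \* derive1n n.-1 f) by [].
have dS (g h : R -> R) : smooth g -> smooth h -> derive1 (g \+ h) = derive1 g \+ derive1 h.
  by move=> ? ?; apply: derive1_addfun => z; exact: smooth_derivable.
rewrite (dS _ _ (smoothD s1 s2) s3) /= (dS _ _ s1 s2) /= (derive1_mulfun sX (sg n.+1)) /=.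
rewrite (derive1_mulfun sY (sg n)) /= (derive1_mulfun (smooth_cst _) (smooth_deriv sX)) /=.
rewrite (derive1_mulfun (smooth_cst K) (sg n.-1)) /= !derive1_cst ddX /K.
case: n {IHn sg s1 s2 s3 sY K} => [|n] /=; first by rewrite !mul0r !mulr0; ring.
rewrite -!natr1.
set D := (fun g : R -> R => derive1 g); rewrite -!/(D _).
move: (X x) (D X x) (D (D (D (derive1n n f))) x) (D (D (derive1n n f)) x) => X0 X1 f3 f2.
move: (D (derive1n n f) x) (derive1n n f x) (n%:R : R) => f1 f0 N; ring.
Qed.

Section Coefficients.
Context {M : manifold} {m k : nat}.
Variables (lambda : 'I_m -> R) (mu delta : R).
Hypothesis deltaE : delta = mu - \sum_j lambda j.
Local Notation I := (mindex m k).

Lemma expresses_uniq (c : chart M) (a b : I -> R -> R) (A : diffop M k lambda mu) :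
  expresses c a A -> expresses c b A -> a = b.
Proof.
move=> [_ aE] [_ bE]; apply/funext => s; apply/funext => x; apply/eqP.
rewrite -subr_eq0; apply/eqP; move: s.
apply: (@coef_uniq R M m k lambda c x) => phi.
under eq_bigr do rewrite mulrBl; rewrite sumrB; apply/eqP.
by rewrite subr_eq0 -aE -bE.
Qed.

(* For X = c0 + c1 x + c2 x^2 the derivatives of order > 2 vanish, so that
   L_X only mixes a_s with a_(s + 1_j). *)
Definition lie_coef (c2 : R) (X : R -> R) (a : I -> R -> R) (s : I) (x : R) : R :=
  X x * derive1 (a s) x + (delta - (mdeg s)%:R) * derive1 X x * a s x
  - c2 * \sum_t lowering lambda t s * a t x.

(** The terms in X times the derivative of a monomial cancel between source and target, and the
    terms in X' combine to the weight mu - \sum_j lambda j - |s| = delta - |s|. *)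
Lemma expresses_lie (c0 c1 c2 : R) (c : chart M) (X : vect R M)
    (a : I -> R -> R) (A : diffop M k lambda mu) :
    (forall x, X c x = c0 + c1 * x + c2 * x ^+ 2) ->
  expresses c a A -> expresses c (lie_coef c2 (X c) a) (lie_diffop X A).
Proof.
move=> /funext XE [sa aE]; have sX : @smooth R (X c) by exact: density_smooth.
split=> [s|phi x].
  have -> : lie_coef c2 (X c) a s = ((X c \* derive1 (a s)) \+
      ((cst (delta - (mdeg s)%:R) \* derive1 (X c)) \* a s)) \+
      (cst (- c2) \* (fun x => \sum_t lowering lambda t s * a t x)).
    by apply/funext => x; rewrite /lie_coef /= mulNr.
  apply: smoothD; last by apply: smoothM; [exact: smooth_cst|exact: smooth_lincomb].
  apply: smoothD; first by apply: smoothM => //; exact: smooth_deriv.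
  by do 2?apply: smoothM => //; [exact: smooth_cst|exact: smooth_deriv].
pose f j := phi j c.
have sf j : smooth (f j) by exact: density_smooth.
have valE : lie_multiop X A phi c x = lie X (diffop_fun A phi) c x -
    \sum_j diffop_fun A (eqtype.dfwith phi (lie X (phi j))) c x.
  have vB (u v : density M mu) : (u - v) c x = u c x - v c x by [].
  have vS (r : seq 'I_m) (B : 'I_m -> density M mu) :
      (\sum_(j <- r) B j) c x = \sum_(j <- r) B j c x.
    by elim/big_rec2: _ => // j u v _ <-.
  by rewrite /lie_multiop vB vS.
rewrite [LHS]valE {valE} /= /lie_fun.
pose mon (s : I) := monom f (fun j => s j).
have smon s : smooth (mon s) by have [] := derive_monom (fun j => s j) x sf.
have AE : diffop_fun A phi c = fun x => \sum_s 1 * (a s \* mon s) x.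
  by apply/funext => z; rewrite aE; apply: eq_bigr => s _; rewrite mul1r.
have sam s : smooth (a s \* mon s) by exact: smoothM.
have -> : derive1 (diffop_fun A phi c) x =
    \sum_s (derive1 (a s) x * mon s x + a s x * derive1 (mon s) x).
  rewrite AE; have /(congr1 (@^~ x)) /= -> := derive1n_lincomb (index_enum _) (fun=> 1) 1 sam.
  by apply: eq_bigr => s _; rewrite mul1r derive1_mulfun.
have dmon (s : I) : derive1 (mon s) x = \sum_j monom f (upd (fun j => s j) j (s j).+1) x.
  by have [] := derive_monom (fun j => s j) x sf.
have lieE (s : I) : \sum_j \prod_l derive1n (s l) (eqtype.dfwith phi (lie X (phi j)) l c) x =
    X c x * derive1 (mon s) x + ((mdeg s)%:R + \sum_j lambda j) * derive1 (X c) x * mon s x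
    + c2 * \sum_t lowering lambda s t * mon t x.
  rewrite dmon (lowering_sum lambda s (fun t => mon t x : R^o)) mulr_sumr /mdeg natr_sum.
  rewrite -big_split /= !mulr_suml mulr_sumr -!big_split; apply: eq_bigr => j _ /=.
  rewrite (bigD1 j) //= eqtype.dfwith_in.
  under eq_bigr => l lj do rewrite eqtype.dfwith_out 1?eq_sym //.
  rewrite (derive1n_lie_quadratic _ _ sX XE (sf j)) /GRing.scale /=.
  rewrite monom_upd /mon (monomE f _ j) (monomE f (fun l => lower j s l) j) lowerE eqxx.
  have -> : \prod_(l | l != j) derive1n (lower j s l) (f l) x =
      \prod_(l | l != j) derive1n (s l) (f l) x.
    by apply: eq_bigr => l /negbTE lj; rewrite lowerE lj.
  set P := \prod_(l | _) derive1n (s l) (f l) x.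
  rewrite -[X in _ * X = _]/P [derive1n (s j).+1 _]/=.
  move: P (X c x) (derive1 (X c) x) (derive1 (derive1n (s j) (f j)) x) => P X0 X1 f1.
  move: (derive1n (s j) (f j) x) (derive1n (s j).-1 (f j) x) => f0 f_; ring.
under [X in _ - X]eq_bigr do rewrite aE.
rewrite exchange_big /=; under [X in _ - X]eq_bigr do rewrite -mulr_sumr lieE.
rewrite aE [RHS](_ : _ = \sum_s ((X c x * derive1 (a s) x +
    (delta - (mdeg s)%:R) * derive1 (X c) x * a s x) * mon s x) -
    c2 * \sum_s a s x * \sum_t lowering lambda s t * mon t x).
  rewrite !mulr_sumr -big_split -!sumrB; apply: eq_bigr => s _ /=.
  rewrite -[\prod_j _]/(mon s x) deltaE.
  move: (\sum_t _) (\sum_j _) (derive1 (a s) x) (derive1 (mon s) x) => S L da dm.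
  move: (mon s x) (X c x) (derive1 (X c) x) => m0 X0 X1; ring.
rewrite /lie_coef; under eq_bigr do rewrite mulrBl.
rewrite sumrB; congr (_ - _).
under eq_bigr do rewrite -mulrA mulr_suml.
rewrite -mulr_sumr; congr (_ * _); under [RHS]eq_bigr do rewrite mulr_sumr.
rewrite [RHS]exchange_big; apply: eq_bigr => s _; apply: eq_bigr => t _.
by rewrite mulrCA mulrA.
Qed.

(** With n = |s| - |i|, the terms in X' have weight n + delta - |s| = delta - |i|. The terms in c2
    have factor n (2 (delta - |s|) + n - 1), a difference of [casimir] values, and the intertwining
    relation cancels them against the lowering terms. *)
Lemma graded_op_lie (c0 c1 c2 : R) (X : R -> R) (a : I -> R -> R)
    (al : I -> I -> R) (i : I) (x : R) :
    smooth X -> X = (fun x => c0 + c1 * x + c2 * x ^+ 2) ->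
    (forall s, smooth (a s)) -> equivariant_coef lambda delta al ->
  graded_op (fun i s => al s i) (lie_coef c2 X a) i x =
  X x * derive1 (graded_op (fun i s => al s i) a i) x +
  (delta - (mdeg i)%:R) * derive1 X x * graded_op (fun i s => al s i) a i x.
Proof.
move=> sX XE sa [al0 al_rec].
have dgop : derive1 (graded_op (fun i s => al s i) a i) x =
    \sum_s al s i * derive1n (mdeg s - mdeg i).+1 (a s) x.
  have sn s : smooth (derive1n (mdeg s - mdeg i) (a s)) by exact: smooth_derivn.
  have := derive1n_lincomb (index_enum _) (fun s => al s i) 1 sn.
  by move=> /(congr1 (@^~ x)).
pose n (s : I) := (mdeg s - mdeg i)%N.
have dlie (s : I) : derive1n (n s) (lie_coef c2 X a s) x =
    X x * derive1n (n s).+1 (a s) x +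
    ((n s)%:R + (delta - (mdeg s)%:R)) * derive1 X x * derive1n (n s) (a s) x +
    c2 * ((n s)%:R * (2 * (delta - (mdeg s)%:R) + (n s)%:R - 1)) * derive1n (n s).-1 (a s) x
    - c2 * \sum_t lowering lambda t s * derive1n (n s) (a t) x.
  have -> : lie_coef c2 X a s = fun x => - c2 * (\sum_t lowering lambda t s * a t x) +
      (X x * derive1 (a s) x + (delta - (mdeg s)%:R) * derive1 X x * a s x).
    by apply/funext => z; rewrite mulNr addrC.
  rewrite derive1n_linear; last 2 first.
  - exact: smooth_lincomb.
  - apply: (@smoothD _ (X \* derive1 (a s)) ((cst (delta - (mdeg s)%:R) \* derive1 X) \* a s)).
      by apply: smoothM => //; exact: smooth_deriv.
    by do 2?apply: smoothM => //; [exact: smooth_cst|exact: smooth_deriv].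
  by rewrite (derive1n_lie_quadratic _ _ sX XE (sa s)) derive1n_lincomb // mulNr addrC.
have lowE : \sum_s al s i * \sum_t lowering lambda t s * derive1n (n s) (a t) x =
    \sum_s (casimir delta (mdeg s) - casimir delta (mdeg i)) * al s i *
      derive1n (n s).-1 (a s) x.
  under eq_bigr do rewrite mulr_sumr; rewrite exchange_big; apply: eq_bigr => t _ /=.
  rewrite al_rec mulr_suml; apply: eq_bigr => s _.
  have [->|/lowering_deg tE] := eqVneq (lowering lambda t s) 0.
    by rewrite !mul0r mulr0.
  rewrite [in RHS]/n tE (_ : (_ - _).-1 = n s); last by rewrite /n; lia.
  by rewrite mulrA [al s i * _]mulrC.
transitivity (\sum_s al s i * (X x * derive1n (n s).+1 (a s) x +
    ((n s)%:R + (delta - (mdeg s)%:R)) * derive1 X x * derive1n (n s) (a s) x +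
    c2 * ((n s)%:R * (2 * (delta - (mdeg s)%:R) + (n s)%:R - 1)) * derive1n (n s).-1 (a s) x)
    - c2 * \sum_s al s i * \sum_t lowering lambda t s * derive1n (n s) (a t) x).
  rewrite mulr_sumr -sumrB; apply: eq_bigr => s _; rewrite dlie mulrBr; congr (_ - _).
  by rewrite mulrCA.
rewrite lowE dgop !mulr_sumr -sumrB -big_split; apply: eq_bigr => s _ /=; rewrite -/(n s).
have [si|si] := ltnP (mdeg s) (mdeg i); first by rewrite al0 // !(mul0r, mulr0) subrr addr0.
have -> : (n s)%:R = (mdeg s)%:R - (mdeg i)%:R :> R by rewrite natrB.
rewrite casimirB.
move: (X x) (derive1 X x) (derive1 (derive1n (n s) (a s)) x) => X0 X1 f1.
move: (derive1n (n s) (a s) x) (derive1n (n s).-1 (a s) x) => f0 f_; ring.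
Qed.
End Coefficients.
End Equivariance.

(** * Construction of the symbol map *)

Lemma symbol_density (R : realType) (M : manifold) m k (lambda : 'I_m -> R) (mu delta : R)
    (A : diffop M k lambda mu) (a : chart M -> mindex m k -> R -> R)
    (al : mindex m k -> mindex m k -> R) (i : mindex m k) (r : nat) :
    (forall l : nat, (2 <= l <= 2 * k)%N -> delta <> l%:R / 2) ->
    delta = mu - \sum_j lambda j -> equivariant_coef lambda delta al ->
    (forall c, expresses c (a c) A) -> mdeg i == r ->
  (fun c => graded_op (fun i s => al s i) (a c) i) \in is_density M (delta - r%:R).
Proof.
move=> nres deltaE al_eq aE /eqP <-; apply/asboolP; split=> [c|].
  by apply: smooth_graded_op; have [] := aE c.
case: M A a aE => //= A a aE y y0.
exact: (graded_op_glued nres deltaE aE).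
Qed.

Lemma layer_coef (R : realType) m k (alpha0 : forall p : 'I_k.+1, 'M[R]_#|{: layer m k p}|) :
  exists B : mindex m k -> mindex m k -> R, extends alpha0 B.
Proof.
pose p (s : mindex m k) : 'I_k.+1 := Ordinal (mdeg_le s : (mdeg s < k.+1)%N).
(* The layer is that of [s]; pairs of different degrees get the default 0. *)
pose B s i := if insub i : option (layer m k (p s)) is Some i' then
  alpha0 (p s) (enum_rank (exist _ s (eqxx _) : layer m k (p s))) (enum_rank i') else 0.
exists B => r [s sr] i.
have rE : p s = r by apply/val_inj/eqP.
case: r / rE sr i => sr i; rewrite /B /= valK; congr (alpha0 _ (enum_rank _) _).
exact: val_inj.
Qed.


Theorem theorem4p1 (R : realType) (M : manifold) (m k : nat)
  (lambda : 'I_m -> R) (mu delta : R) (m_gt0 : (0 < m)%N)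
  (deltaE : delta = mu - \sum_j lambda j)
  (delta_nres : forall l : nat, (2 <= l <= 2 * k)%N -> delta <> l%:R / 2)
  (alpha0 : forall p : 'I_k.+1, 'M[R]_#|{: layer m k p}|)
  (alpha0_unit : forall p, alpha0 p \in unitmx) :
  exists alpha : mindex m k -> mindex m k -> R,
    [/\ extends alpha0 alpha,
        induction_formula lambda delta alpha,
        forall beta : mindex m k -> mindex m k -> R,
          extends alpha0 beta -> induction_formula lambda delta beta ->
          forall s i, (mdeg i <= mdeg s)%N -> beta s i = alpha s i
      & exists sigma : {linear diffop M k lambda mu -> symbols M m k delta},
          given_by alpha sigma /\ sl2_equivariant sigma].
Proof.
have [B BE] := layer_coef alpha0.
have [al [al_eq alB]] := equivariant_coef_exists lambda delta_nres B.
have [al0 al_rec] := al_eq.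
have q_inj s i := casimir_inj (m := m) s i delta_nres.
have recE (be : mindex m k -> mindex m k -> R) (s i : mindex m k) :
    \sum_(j | (0 < s j)%N) (s j)%:R * (2 * lambda j + (s j)%:R - 1) * be (lower j s) i =
    \sum_t lowering lambda s t * be t i.
  rewrite (lowering_sum lambda s (fun t => be t i : R^o)) big_mkcond /=.
  apply: eq_bigr => j _; case: ltnP => //; rewrite leqn0 => /eqP ->.
  by rewrite mul0r scale0r.
have formulaE be : induction_formula lambda delta be <->
    forall s i : mindex m k, (mdeg i < mdeg s)%N ->
      (casimir delta (mdeg s) - casimir delta (mdeg i)) * be s i =
      \sum_t lowering lambda s t * be t i.
  by split=> h s i si; have := h s i si; rewrite casimirB recE;
    [move=> /eqP; rewrite subr_eq0 => /eqP|move=> ->; rewrite subrr].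
have al_ext : extends alpha0 al.
  by move=> p s i; rewrite alB // (eqP (valP s)) (eqP (valP i)).
have topE be ga : extends alpha0 be -> extends alpha0 ga ->
    forall s i : mindex m k, mdeg s = mdeg i -> be s i = ga s i.
  move=> beE gaE s i si; pose p : 'I_k.+1 := Ordinal (mdeg_le s : (mdeg s < k.+1)%N).
  have ip : mdeg i == p by rewrite -si.
  pose s' : layer m k p := exist _ s (eqxx _); pose i' : layer m k p := exist _ i ip.
  by rewrite -[s]/(val s') -[i]/(val i') beE gaE.
exists al; split=> //; first by apply/formulaE => s i _; exact: al_rec.
  move=> be beE /formulaE be_rec; apply: (triangular_uniq q_inj (@lowering_deg R m k lambda)) => //.
  exact: topE.
have coefP (A : diffop M k lambda mu) c : exists a : mindex m k -> R -> R, expresses c a A.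
  by have /asboolP := valP A; apply.
(* Coefficients are chosen in each chart; [expresses_uniq] makes the choice immaterial. *)
pose coef A c := sval (cid (coefP A c)).
have coefE A c : expresses c (coef A c) A := svalP (cid (coefP A c)).
pose sigma (A : diffop M k lambda mu) : symbols M m k delta := fun r i =>
  Density (symbol_density delta_nres deltaE al_eq (coefE A) (valP i)).
have sigmaE (A : diffop M k lambda mu) (a : mindex m k -> R -> R) (r : 'I_k.+1) (i : layer m k r) x : expresses (affine M) a A ->
    sigma A r i (affine M) x = graded_op (fun i s => al s i) a (val i) x.
  by move=> aE; rewrite /= (expresses_uniq (coefE A _) aE).
have lin_sigma : linear sigma.
  move=> t A A'; apply: functional_extensionality_dep => r.
  apply: functional_extensionality_dep => i; apply: density_ext => x.
  have [sa aE] := coefE A (affine M); have [sb bE] := coefE A' (affine M).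
  set a := coef A _ in sa aE; set b := coef A' _ in sb bE.
  have abE : expresses (affine M) (fun s x => t * a s x + b s x) (t *: A + A').
    split=> [s|phi y].
      by apply: smoothD => //; apply: (@smoothM _ (cst t)) => //; exact: smooth_cst.
    under eq_bigr do rewrite mulrDl -mulrA.
    by rewrite big_split/= -mulr_sumr -aE -bE.
  rewrite (sigmaE _ _ _ _ _ abE).
  rewrite [RHS](_ : _ = t * sigma A r i (affine M) x + sigma A' r i (affine M) x) //.
  rewrite /= /graded_op mulr_sumr -big_split; apply: eq_bigr => s _ /=.
  by rewrite derive1n_linear // mulrDr mulrCA.
pose sigma_lin : {linear diffop M k lambda mu -> symbols M m k delta} :=
  HB.pack sigma (GRing.isLinear.Build R _ _ _ sigma lin_sigma).
exists sigma_lin; split=> [A a aE r i x|X [c0 [c1 [c2 XE]]] A].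
  rewrite [LHS](sigmaE _ _ _ _ _ aE) /graded_op [RHS]big_mkcond /=.
  have ir : mdeg (val i) = r by apply/eqP/(valP i).
  apply: eq_bigr => s _; rewrite ir; case: ltnP => // sr.
  by rewrite al0 ?mul0r // ir.
(* Both sides are densities, so they are compared in the affine coordinate, where [X] is
   quadratic. *)
apply: functional_extensionality_dep => r.
apply: functional_extensionality_dep => i; apply: density_ext => x.
have sX : @smooth R (X (affine M)) by exact: density_smooth.
have aE := coefE A (affine M).
rewrite [LHS](sigmaE _ _ _ _ _ (expresses_lie deltaE XE aE)).
have ir : mdeg (val i) = r by apply/eqP/(valP i).
rewrite (graded_op_lie _ _ sX (funext XE) _ al_eq); last by have [] := aE.
by rewrite ir.
Qed.
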